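(* In the setting of the context, for $\varepsilon\in[0,1]$ let $p(\varepsilon)$ be the solution of the dual problem $\sup_p\Phi(p,\varepsilon)$ with the normalization $p_1(\varepsilon)=0$. Then $\varepsilon\mapsto p(\varepsilon)$ is the only solution on $[0,1]$ of the ordinary differential equation $$\frac{dp}{d\varepsilon}(\varepsilon)=-\big[D^2_{p,p}\Phi(p(\varepsilon),\varepsilon)\big]^{-1}\left(\frac{\partial}{\partial\varepsilon}\nabla_p\Phi(p(\varepsilon),\varepsilon)\right)$$ with initial condition $p(0)$ such that all the horizontal strips $C(p(0),0)_i$, $i=1,\dots,N$, have area $1/N$.
   Context: Setting: $\Omega\subset\mathbb{R}^2$ is a (bounded) convex polygon with area $|\Omega|=1$, $\mu$ is the uniform measure on $\Omega$, and $\nu=\frac1N\sum_{i=1}^N\delta_{y_i}$, where $y_1,\dots,y_N\in\Omega$ are points whose second coordinates $y_i^{(2)}$ are pairwise different. For $\varepsilon\in[0,1]$, $A_\varepsilon=\mathrm{diag}(\varepsilon,1)$ and $c_\varepsilon(x,y)=\langle A_\varepsilon(x-y),x-y\rangle=\varepsilon(x^{(1)}-y^{(1)})^2+(x^{(2)}-y^{(2)})^2$. For $p\in\mathbb{R}^N$, define $$\Phi(p,\varepsilon)=\frac1N\sum_{i=1}^N p_i+\int_\Omega\min_i\{c_\varepsilon(x,y_i)-p_i\}\,dx,$$ the dual functional of the optimal transport problem between $\mu$ and $\nu$ for the cost $c_\varepsilon$, and the cells $$C(p,\varepsilon)_i=\Big\{x\in\Omega:\ \min_j\,(c_\varepsilon(x,y_j)-p_j)=c_\varepsilon(x,y_i)-p_i\Big\},\qquad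 i=1,\dots,N.$$ For each $\varepsilon$, with the normalization $p_1=0$, $\Phi(\cdot,\varepsilon)$ has a unique maximizer $p(\varepsilon)$, and $\frac{\partial\Phi}{\partial p_i}(p,\varepsilon)=\frac1N-|C(p,\varepsilon)_i|$ ($|\cdot|$ denotes area). Conventions: $p_1\equiv0$ throughout, and $p$ is identified with $(p_2,\dots,p_N)\in\mathbb{R}^{N-1}$; $\nabla_p\Phi$ and $D^2_{p,p}\Phi$ denote the gradient and the $(N-1)\times(N-1)$ Hessian with respect to $(p_2,\dots,p_N)$. The differential equation is set in $$\mathcal{O}=\Big\{(p,\varepsilon):\ \varepsilon\in[0,1],\ \tfrac{1}{2N}<|C(p,\varepsilon)_i|<\tfrac{2}{N}\ \text{for every } i\Big\},$$ on which these second derivatives exist and $D^2_{p,p}\Phi$ is invertible; solutions are curves with $(p(\varepsilon),\varepsilon)\in\mathcal{O}$. *)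

(* Defs.v *)
From HB Require Import structures.
From mathcomp Require Import all_boot all_order all_algebra.
From mathcomp Require Import all_classical all_reals all_analysis.
Set Implicit Arguments.
Unset Strict Implicit.
Unset Printing Implicit Defensive.
Import Order.TTheory GRing.Theory Num.Theory.
Import numFieldNormedType.Exports.
Local Open Scope classical_set_scope.
Local Open Scope ring_scope.

Definition leb2 (R : realType) :
  set (measurableTypeR R * measurableTypeR R) -> \bar R :=
  (@lebesgue_measure R \x @lebesgue_measure R)%E.

Definition area (R : realType) (A : set (R * R)) : R := fine (leb2 A).

(* Degenerate (empty, point, segment) hulls are not excluded here; they have
   area 0. *)
Definition convex_polygon (R : realType) (Omega : set (R * R)) : Prop :=
  exists (m : nat) (v : 'I_m -> R * R),
    Omega = [set x | exists w : 'I_m -> R,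
      [/\ forall k, 0 <= w k, \sum_k w k = 1 &
          x = (\sum_k w k * (v k).1, \sum_k w k * (v k).2)]].

Definition cost (R : realType) (eps : R) (x y : R * R) : R :=
  eps * (x.1 - y.1) ^+ 2 + (x.2 - y.2) ^+ 2.

(* The number of points is N = n.+1; the index 1 of the normalization p_1 = 0
   is ord0, and the indices 2, ..., N are the lift ord0 i for i : 'I_n. *)
Definition min_cost (R : realType) (n : nat) (y : 'I_n.+1 -> R * R)
    (p : 'rV[R]_n.+1) (eps : R) (x : R * R) : R :=
  \big[Num.min/cost eps x (y ord0) - p ord0 ord0]_(i < n.+1)
    (cost eps x (y i) - p ord0 i).

Definition Phi (R : realType) (Omega : set (R * R)) (n : nat)
    (y : 'I_n.+1 -> R * R) (p : 'rV[R]_n.+1) (eps : R) : R :=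
  n.+1%:R^-1 * (\sum_(i < n.+1) p ord0 i) +
  \int[@leb2 R]_(x in Omega) min_cost y p eps x.

Definition cell (R : realType) (Omega : set (R * R)) (n : nat)
    (y : 'I_n.+1 -> R * R) (p : 'rV[R]_n.+1) (eps : R) (i : 'I_n.+1) :
    set (R * R) :=
  [set x | Omega x /\ min_cost y p eps x = cost eps x (y i) - p ord0 i].

Definition dual_solution (R : realType) (Omega : set (R * R)) (n : nat)
    (y : 'I_n.+1 -> R * R) (eps : R) (p : 'rV[R]_n.+1) : Prop :=
  p ord0 ord0 = 0 /\ forall q : 'rV[R]_n.+1, Phi Omega y q eps <= Phi Omega y p eps.

(* [deriv01] and [is_deriv01] are derivatives relative to [0, 1]: one-sided at
   the endpoints 0 and 1, two-sided in between. *)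
Definition deriv01 (R : realType) (f : R -> R) (x : R) : R :=
  lim ((f e - f x) / (e - x) @[e --> within `[0, 1] x^']).

Definition is_deriv01 (R : realType) (f : R -> R) (x l : R) : Prop :=
  (f e - f x) / (e - x) @[e --> within `[0, 1] x^'] --> l.

Definition dPhi (R : realType) (Omega : set (R * R)) (n : nat)
    (y : 'I_n.+1 -> R * R) (i : 'I_n) (p : 'rV[R]_n.+1) (eps : R) : R :=
  'D_(delta_mx ord0 (lift ord0 i)) (fun q => Phi Omega y q eps) p.

Definition hessPhi (R : realType) (Omega : set (R * R)) (n : nat)
    (y : 'I_n.+1 -> R * R) (p : 'rV[R]_n.+1) (eps : R) : 'M[R]_n :=
  \matrix_(i, j)
    'D_(delta_mx ord0 (lift ord0 i)) (fun q => dPhi Omega y j q eps) p.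

Definition deps_gradPhi (R : realType) (Omega : set (R * R)) (n : nat)
    (y : 'I_n.+1 -> R * R) (p : 'rV[R]_n.+1) (eps : R) : 'cV[R]_n :=
  \col_i deriv01 (fun e => dPhi Omega y i p e) eps.

Definition ode_domain (R : realType) (Omega : set (R * R)) (n : nat)
    (y : 'I_n.+1 -> R * R) (p : 'rV[R]_n.+1) (eps : R) : Prop :=
  [/\ p ord0 ord0 = 0, 0 <= eps <= 1 &
      forall i, (2 * n.+1%:R)^-1 < area (cell Omega y p eps i) < 2 / n.+1%:R].

Definition ode_solution (R : realType) (Omega : set (R * R)) (n : nat)
    (y : 'I_n.+1 -> R * R) (p : R -> 'rV[R]_n.+1) : Prop :=
  forall eps : R, 0 <= eps <= 1 ->
    ode_domain Omega y (p eps) eps /\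
    forall i : 'I_n,
      is_deriv01 (fun e => p e ord0 (lift ord0 i)) eps
        ((- (invmx (hessPhi Omega y (p eps) eps)
             *m deps_gradPhi Omega y (p eps) eps)) i ord0).

Definition initial_condition (R : realType) (Omega : set (R * R)) (n : nat)
    (y : 'I_n.+1 -> R * R) (p0 : 'rV[R]_n.+1) : Prop :=
  forall i : 'I_n.+1, area (cell Omega y p0 0 i) = n.+1%:R^-1.

(* Main.v *)
Require Import Defs.
From HB Require Import structures.
From mathcomp Require Import all_boot all_order all_algebra.
From mathcomp Require Import all_classical all_reals all_analysis.
From mathcomp Require Import measurable_realfun.
From mathcomp Require Import ring lra.
(** Let F_i(p, eps) be the area of the i-th cell, so that the i-th partial
    derivative of Phi(., eps) is 1/N - F_i.  On a vertical line two shifted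
    costs differ by an affine function of nonzero slope, hence a cell meets the
    line in a segment whose ends are minima and maxima of functions that are
    affine in (p, eps).  So F is Lipschitz; if all cells have positive area,
    then, for all but finitely many vertical lines, the length of this segment
    is an affine function of the parameters near the given ones, and F is
    Frechet differentiable by dominated convergence.

    If the coordinates of p in a group S increase by at least g more than the
    others, the cells of S gain in total an area of at least c g for small g:
    the difference D of the minimal shifted costs in S and outside S is
    Lipschitz and changes sign on an open set of vertical lines.  With S taken
    above a gap between the values of q - p, this bounds |F(q) - F(p)| below by
    c min(|q - p|, d).  This single estimate yields the uniqueness of the
    critical point, the invertibility of the Hessian, and the Lipschitz
    dependence of p(eps) on eps.

    Expanding F(p(eps), eps) = 1/N then gives the differential equation.
    Conversely, F(q(eps), eps) has zero derivative along any solution q, so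
    that q(eps) remains critical. *)

Set Implicit Arguments.
Unset Strict Implicit.
Unset Printing Implicit Defensive.
Import Order.TTheory GRing.Theory Num.Theory.
Import numFieldNormedType.Exports.
Local Open Scope classical_set_scope.
Local Open Scope ring_scope.

(** * Convex sets in the plane *)

(** Distinct second coordinates make [eps = 0] an ordinary parameter: in the difference of two
    shifted costs the coefficient of the second coordinate of [x] is [2 * ((y j).2 - (y i).2)],
    whatever [p] and [eps]. All slicing is therefore vertical, and the formulas hold for every real
    [eps], so that expansions at the ends 0 and 1 are two-sided; only the curves are confined to
    [[0, 1]].

    The areas are expanded at one point at a time, without continuity of the coefficients, so
    neither the implicit function theorem nor the Picard-Lindelof theorem is at hand.
    Differentiability of [p(eps)] is drawn from its Lipschitz bound instead, and uniqueness from the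
    areas being first integrals. Both steps control an error along a curve, hence the need for
    differentiability in [(p, eps)] jointly.

    Reading invertibility of the Hessian off line integrals over common edges would require knowing
    which cells touch. Comparing two groups of cells uses only that each group contains a cell of
    positive area. *)

Definition convex2 (R : realType) (A : set (R * R)) : Prop :=
  forall (x z : R * R) (l : R), A x -> A z -> 0 <= l <= 1 ->
    A ((1 - l) * x.1 + l * z.1, (1 - l) * x.2 + l * z.2).

Lemma convex_polygon_convex (R : realType) (Om : set (R * R)) :
  convex_polygon Om -> convex2 Om.
Proof.
move=> [m [v ->]] x z l [w [w0 w1 ->]] [u [u0 u1 ->]] /andP[l0 l1] /=.
exists (fun k => (1 - l) * w k + l * u k); split.
- by move=> k; rewrite addr_ge0 ?mulr_ge0 ?subr_ge0.
- by rewrite big_split -!mulr_sumr /= w1 u1; ring.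
- by congr pair; rewrite !mulr_sumr -big_split /=; apply: eq_bigr => k _; ring.
Qed.

Lemma rV_continuous_sum (R : realType) m (c : 'I_m -> R) :
  continuous (fun w : 'rV[R]_m => \sum_k w ord0 k * c k).
Proof.
apply: continuous_big => [|k _ w]; first exact: add_continuous.
exact: (cvgM (@coord_continuous R 1 m ord0 k w) (cvg_cst (c k))).
Qed.

(** The polygon is the image of the simplex of weights, a closed and bounded subset of ['rV[R]_m],
    under a continuous map. *)
Lemma convex_polygon_compact (R : realType) (Om : set (R * R)) :
  convex_polygon Om -> compact Om.
Proof.
move=> [m [v ->]].
pose S : set 'rV[R]_m := [set w | (forall k, 0 <= w ord0 k) /\ \sum_k w ord0 k = 1].
pose f (w : 'rV[R]_m) : R * R :=
  (\sum_k w ord0 k * (v k).1, \sum_k w ord0 k * (v k).2).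
rewrite [X in compact X](_ : _ = f @` S); last first.
  apply/seteqP; split => [x [w [w0 w1 ->]]|x [w [w0 w1] <-]].
    exists (\row_k w k); last by rewrite /f; congr pair; apply: eq_bigr => k _; rewrite mxE.
    by split => [k|]; [rewrite mxE|rewrite -w1; apply: eq_bigr => k _; rewrite mxE].
  by exists (w ord0).
apply: continuous_compact.
  apply: continuous_subspaceT => w.
  exact: (cvg_pair (@rV_continuous_sum _ _ (fun k => (v k).1) w)
    (@rV_continuous_sum _ _ (fun k => (v k).2) w)).
have sc : continuous (fun w : 'rV[R]_m => \sum_k w ord0 k).
  move=> w; have := @rV_continuous_sum R m (fun=> 1) w.
  by under [in X in X -> _]eq_fun do under eq_bigr do rewrite mulr1.
apply: bounded_closed_compact.
  exists 1; split => // M M1 w [w0 w1].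
  rewrite /= /Num.Def.normr /= mx_normrE; apply/bigmax_leP; split=> [|[i k] _ /=].
    by rewrite (le_trans _ (ltW M1)).
  rewrite !ord1 ger0_norm ?w0 // (le_trans _ (ltW M1)) // -w1 (bigD1 k) //=.
  by rewrite lerDl sumr_ge0.
rewrite (_ : S = (\bigcap_k [set w | 0 <= w ord0 k]) `&`
    [set w | \sum_k w ord0 k = 1]); last first.
  apply/seteqP; split => w [h1 h2]; split => // k; first by move=> _; exact: h1.
  exact: (h1 k I).
apply: closedI.
  apply: closed_bigI => k _.
  apply: (@closed_comp _ _ (fun w : 'rV[R]_m => w ord0 k) [set x | 0 <= x]).
    by move=> w _; exact: coord_continuous.
  exact: closed_ge.
apply: (@closed_comp _ _ (fun w : 'rV[R]_m => \sum_k w ord0 k) [set x | x = 1]).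
  by move=> w _; exact: sc.
exact: closed_eq.
Qed.

(** Bridge from the product topology to the product sigma-algebra: a closed set is the intersection
    over [k] of the unions of the countably many boxes with rational centre and half-side [1/(k+1)]
    that meet it. *)
Lemma closed_measurable2 (R : realType)
    (A : set (measurableTypeR R * measurableTypeR R)) :
  closed (A : set (R * R)) -> measurable A.
Proof.
move=> cA.
pose box (k : nat) (q : rat * rat) : set (R * R) :=
  [set x | `|x.1 - ratr q.1| < k.+1%:R^-1 /\ `|x.2 - ratr q.2| < k.+1%:R^-1].
pose B (k : nat) (q : rat * rat) : set (R * R) :=
  [set x | box k q x /\ exists z, A z /\ box k q z].
have AE : A = \bigcap_k \bigcup_q B k q.
  apply/seteqP; split => [x Ax k _|x Bx].
    have k0 : (0 : R) < k.+1%:R^-1 by rewrite invr_gt0.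
    have near_rat (c : R) : exists q : rat, `|c - ratr q| < k.+1%:R^-1.
      move: k0; move: (k.+1%:R^-1) => e e0.
      have [|q] := @rat_in_itvoo R (c - e) (c + e); first by lra.
      rewrite in_itv /= => /andP[q1 q2]; exists q; rewrite ltr_norml; apply/andP; split; lra.
    have [q1 hq1] := near_rat x.1; have [q2 hq2] := near_rat x.2.
    by exists (q1, q2) => //; split => //; exists x.
  apply: cA => V /nbhs_ballP[e /= e0 xeV].
  have /ltr_add_invr[k hk] : 0 < e / 2 by rewrite divr_gt0.
  rewrite add0r in hk.
  have [q _ [[x1 x2] [z [Az [z1 z2]]]]] := Bx k I.
  move: hk x1 x2 z1 z2; move: (k.+1%:R^-1) => d hk x1 x2 z1 z2.
  exists z; split => //; apply: xeV; split; rewrite /ball /=.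
    rewrite (le_lt_trans (ler_distD (ratr q.1) _ _)) // (distrC (ratr _)); lra.
  rewrite (le_lt_trans (ler_distD (ratr q.2) _ _)) // (distrC (ratr _)); lra.
rewrite AE; apply: bigcapT_measurable => k.
apply: countable_bigcupT_measurable => // q.
(* That the box meets [A] does not depend on [x], so [B k q] is empty or the whole box. *)
have [[z hz]|nz] := pselect (exists z, A z /\ box k q z); last first.
  rewrite (_ : B k q = set0); first exact: measurable0.
  by apply/seteqP; split => // x [_ /nz].
rewrite (_ : B k q = ball (ratr q.1 : R) k.+1%:R^-1 `*` ball (ratr q.2 : R) k.+1%:R^-1).
  by rewrite !ball_itv; apply: measurableX; exact: measurable_itv.
apply/seteqP; split => x; rewrite /B /box /ball /= ![`|ratr _ - _|]distrC.
  by case.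
by move=> ?; split => //; exists z.
Qed.

(** * Cells and their vertical sections *)

Section Cells.
Context (R : realType) (Om : set (R * R)) (n : nat) (y : 'I_n.+1 -> R * R).
Implicit Types (p q : 'rV[R]_n.+1) (e t : R) (i j : 'I_n.+1) (x : R * R).

Definition shifted_cost p e i x : R := cost e x (y i) - p ord0 i.

Local Notation h := shifted_cost.
Local Notation C := (cell Om y).

Lemma min_cost_le p e i x : min_cost y p e x <= h p e i x.
Proof. by rewrite /min_cost; apply: bigmin_le_cond. Qed.

Lemma min_cost_attained p e x : exists i, min_cost y p e x = h p e i x.
Proof.
rewrite /min_cost -/(h p e ord0 x).
elim/big_ind : _ => [|a b [i ->] [j ->]|i _]; [by exists ord0| |by exists i].
by rewrite /Num.min; case: ifP => _; [exists i|exists j].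
Qed.

Lemma cellP p e i x : C p e i x <-> Om x /\ forall j, h p e i x <= h p e j x.
Proof.
split => -[Ox]; first by move=> Hi; split => // j; rewrite /h -Hi; exact: min_cost_le.
move=> H; split => //; apply/le_anti; rewrite min_cost_le /=.
by have [j ->] := min_cost_attained p e x.
Qed.

Lemma cell_covers p e x : Om x -> exists i, C p e i x.
Proof.
by move=> Ox; have [i Hi] := min_cost_attained p e x; exists i; split.
Qed.

(* The height at which the costs of [i] and [j] agree on the vertical line of
   abscissa [t]. *)
Definition tie p e i j t : R :=
  (p ord0 i - p ord0 j - e * ((y i).1 ^+ 2 - (y j).1 ^+ 2)
   - ((y i).2 ^+ 2 - (y j).2 ^+ 2) + 2 * e * t * ((y i).1 - (y j).1))
  / (2 * ((y j).2 - (y i).2)).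

(** The quadratic parts in [x] agree for all indices and cancel, so that a cell is cut out of [Om]
    by affine inequalities. *)
Lemma shifted_costB_affine p e i j x z l :
  h p e i ((1 - l) * x.1 + l * z.1, (1 - l) * x.2 + l * z.2) -
  h p e j ((1 - l) * x.1 + l * z.1, (1 - l) * x.2 + l * z.2) =
  (1 - l) * (h p e i x - h p e j x) + l * (h p e i z - h p e j z).
Proof. by rewrite /h /cost /=; ring. Qed.

Lemma convex_cell p e i : convex2 Om -> convex2 (C p e i).
Proof.
move=> Oc x z l /cellP[Ox hx] /cellP[Oz hz] l01; apply/cellP; split; first exact: Oc.
move=> j; rewrite -subr_le0 shifted_costB_affine.
have := hx j; have := hz j; rewrite -subr_le0 => h1; rewrite -subr_le0 => h2.
case/andP: l01 => l0 l1.
have := mulr_ge0_le0 l0 h1; have : 0 <= 1 - l by lra.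
by move=> /mulr_ge0_le0 /(_ h2) => *; lra.
Qed.

Lemma measurable_shifted_cost p e i :
  measurable_fun [set: measurableTypeR R * measurableTypeR R] (h p e i).
Proof.
rewrite /h /cost; apply: measurable_funB; last exact: measurable_cst.
apply: measurable_funD; last first.
  by apply: measurable_funX; apply: measurable_funB.
by apply: measurable_funM => //; apply: measurable_funX; apply: measurable_funB.
Qed.

Context (yh : forall i j, i != j -> (y i).2 != (y j).2).

Lemma shifted_costB p e i j x : i != j ->
  h p e i x - h p e j x = 2 * ((y j).2 - (y i).2) * (x.2 - tie p e i j x.1).
Proof.
move=> ij; have := yh ij; rewrite eq_sym -subr_eq0 => b0.
rewrite /h /cost /tie; field.
by rewrite b0.
Qed.

Lemma tieC p e i j t : i != j -> tie p e i j t = tie p e j i t.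
Proof.
move=> ij; have := yh ij; rewrite eq_sym -subr_eq0 => b0.
have b1 : (y i).2 - (y j).2 != 0 by rewrite -opprB oppr_eq0.
rewrite /tie; field.
by rewrite b0 b1.
Qed.

Lemma le_shifted_cost_above p e i j x : (y i).2 < (y j).2 ->
  (h p e i x <= h p e j x) = (x.2 <= tie p e i j x.1).
Proof.
move=> ij; have nij : i != j by apply: contraTneq ij => ->; rewrite ltxx.
by rewrite -subr_le0 shifted_costB // pmulr_rle0 ?subr_le0 // mulr_gt0 // subr_gt0.
Qed.

Lemma le_shifted_cost_below p e i j x : (y j).2 < (y i).2 ->
  (h p e i x <= h p e j x) = (tie p e i j x.1 <= x.2).
Proof.
move=> ij; have nij : i != j by apply: contraTneq ij => ->; rewrite ltxx.
by rewrite -subr_le0 shifted_costB // nmulr_rle0 ?subr_ge0 // pmulr_rlt0 // subr_lt0.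
Qed.

Context (Om_measurable : measurable (Om : set (measurableTypeR R * measurableTypeR R))).

Lemma measurable_cell p e i :
  measurable (C p e i : set (measurableTypeR R * measurableTypeR R)).
Proof.
rewrite (_ : C p e i = Om `&` \bigcap_(j in [set: 'I_n.+1])
    [set x | h p e i x <= h p e j x]).
  apply: measurableI => //; apply: fin_bigcap_measurable => // j _.
  rewrite -[X in measurable X]setTI.
  exact: (measurable_fun_le measurableT
   (measurable_shifted_cost _ _ _) (measurable_shifted_cost _ _ _)).
apply/seteqP; split => x; first by move=> /cellP[Ox H]; split => // j _; exact: H.
by move=> [Ox H]; apply/cellP; split => // j; exact: H.
Qed.

Lemma leb2_null_sections (B : set (measurableTypeR R * measurableTypeR R)) (f : R -> R) :
  measurable B -> (forall x, B x -> x.2 = f x.1) -> leb2 B = 0%E.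
Proof.
move=> mB Bf; apply: integral0_eq => t _ /=.
apply/eqP; rewrite eq_le measure_ge0 andbT -(lebesgue_measure_set1 (f t)).
apply: le_measure; rewrite ?inE //; first exact: measurable_xsection.
by move=> s /xsectionP /Bf.
Qed.

(** Two cells meet only on the graph of their [tie], which cuts each vertical line in one point. *)
Lemma leb2_cell_overlap p e i j : i != j -> leb2 (C p e i `&` C p e j) = 0%E.
Proof.
move=> ij; apply: (@leb2_null_sections _ (tie p e i j)).
  by apply: measurableI; exact: measurable_cell.
move=> x [/cellP[_ /(_ j) h1] /cellP[_ /(_ i) h2]].
have := shifted_costB p e x ij; have -> : h p e i x = h p e j x by apply/le_anti/andP.
move=> /esym/eqP; rewrite subrr mulf_eq0 mulf_eq0 subr_eq0 [in X in _ || X || _]eq_sym.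
by rewrite pnatr_eq0 (negbTE (yh ij)) /= subr_eq0 => /eqP.
Qed.

Context (Om_fin : (leb2 Om < +oo)%E).

Lemma leb2_cell_union p e (s : seq 'I_n.+1) : uniq s ->
  leb2 (\big[setU/set0]_(i <- s) C p e i) = (\sum_(i <- s) leb2 (C p e i))%E.
Proof.
elim: s => [|i s IH]; first by rewrite !big_nil /leb2 measure0.
rewrite /= => /andP[si us]; rewrite !big_cons -IH //.
have mU (r : seq 'I_n.+1) : measurable
    (\big[setU/set0]_(i <- r) C p e i : set (measurableTypeR R * measurableTypeR R)).
  by apply: bigsetU_measurable => k _; exact: measurable_cell.
have mC := measurable_cell p e i.
rewrite /leb2 measureUfinl //; last first.
  apply: le_lt_trans Om_fin; apply: le_measure; rewrite ?inE //.
  by move=> x [].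
rewrite (_ : (_ (_ `&` _)) = 0%E) ?sube0 //.
elim: s {IH us} si => [|k s IH]; first by rewrite big_nil setI0 measure0.
rewrite inE negb_or => /andP[ik si]; rewrite big_cons setIUr.
rewrite measureU0; first exact: leb2_cell_overlap.
- by apply: measurableI => //; exact: measurable_cell.
- exact: measurableI.
- exact: IH.
Qed.

End Cells.

Lemma convex2_vertical (R : realType) (A : set (R * R)) (t a b s : R) :
  convex2 A -> A (t, a) -> A (t, b) -> a <= s <= b -> A (t, s).
Proof.
move=> cA Aa Ab /andP[as_ sb].
have [ab|ab] := ltP a b; last by have -> : s = a by lra.
have := cA _ _ ((s - a) / (b - a)) Aa Ab; rewrite /=.
have ba0 : b - a != 0 by rewrite subr_eq0 gt_eqF.
rewrite (_ : _ + _ * t = t); last by ring.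
rewrite (_ : _ + _ * b = s); last by field.
apply; rewrite divr_ge0 ?ler_pdivrMr //=; lra.
Qed.

(** If at most one vertical line met [A] in two points, almost every section would have at most one
    point and the area would vanish. Two such lines span a trapezoid inside [A], and a box fits
    around its centre. *)
Lemma convex2_box (R : realType)
    (A : set (measurableTypeR R * measurableTypeR R)) :
  measurable A -> convex2 (A : set (R * R)) -> (0 < leb2 A)%E ->
  exists (z : R * R) (r : R), 0 < r /\
    forall x : R * R, `|x.1 - z.1| <= r -> `|x.2 - z.2| <= r -> A x.
Proof.
move=> mA cA A0.
pose T := [set t : R | exists a b : R, a < b /\ A (t, a) /\ A (t, b)].
have [t1 [t2 [t12 [T1 T2]]]] : exists t1 t2, t1 < t2 /\ T t1 /\ T t2.
  apply: contrapT => noT; suff A00 : leb2 A = 0%E by rewrite A00 ltxx in A0.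
  have [t0 Tt0] : exists t0, forall t, T t -> t = t0.
    have [[t0 T0]|nT] := pselect (exists t0, T t0); last first.
      by exists 0 => t Tt; exfalso; apply: nT; exists t.
    exists t0 => t Tt; apply: contrapT => /eqP; rewrite neq_lt => /orP[|] tt0; apply: noT.
      by exists t, t0.
    by exists t0, t.
  rewrite /leb2 /product_measure1.
  rewrite -[RHS](@integral0 _ _ _ (@lebesgue_measure R) setT).
  apply: ae_eq_integral => //; first exact: measurable_fun_xsection.
  exists [set t0]; split => //=; first exact: lebesgue_measure_set1.
  move=> t /= H; apply: Tt0; apply: contrapT => nT; apply: H => _.
  apply/eqP; rewrite eq_le measure_ge0 andbT.
  have [[s As]|nA] := pselect (exists s, A (t, s)); last first.
    rewrite (_ : xsection A t = set0) ?measure0 //; apply/seteqP; split => // s /xsectionP As.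
    by apply: nA; exists s.
  rewrite -(lebesgue_measure_set1 s); apply: le_measure; rewrite ?inE //.
    exact: measurable_xsection.
  move=> u /xsectionP Au; apply: contrapT => /eqP; rewrite neq_lt => /orP[|] us; apply: nT.
    by exists u, s.
  by exists s, u.
move: T1 T2 => [a1 [b1 [ab1 [Aa1 Ab1]]]] [a2 [b2 [ab2 [Aa2 Ab2]]]].
(* [w] is half the height of the trapezoid on its middle line, and [K / d] bounds the slopes of its
   edges. The choice of [r] gives [r + (r / d) * K <= w], which keeps the box between the edges. *)
pose w := (b1 - a1 + (b2 - a2)) / 4.
pose K := `|a2 - a1| + `|b2 - b1|.
pose d := t2 - t1.
have d0 : 0 < d by rewrite /d; lra.
have w0 : 0 < w by rewrite /w divr_gt0 //; lra.
have K0 : 0 <= K by rewrite addr_ge0.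
pose r := Num.min (d / 2) (w / (1 + K / d)).
have Kd0 : 0 <= K / d by rewrite divr_ge0 // ltW.
have r0 : 0 < r by rewrite lt_min !divr_gt0 //; lra.
have rd : r <= d / 2 by rewrite /r ge_min lexx.
have rw : r + (r / d) * K <= w.
  have : r <= w / (1 + K / d) by rewrite /r ge_min lexx orbT.
  rewrite ler_pdivlMr; last by lra.
  by rewrite mulrDr mulr1 -mulrA (mulrC d^-1).
exists ((t1 + t2) / 2, (a1 + a2 + b1 + b2) / 4), r; split => // -[t s] /= tr sr.
pose l := (t - t1) / d.
have tl : t = (1 - l) * t1 + l * t2.
  by rewrite /l /d; field; rewrite subr_eq0 gt_eqF.
have lE : l - 2^-1 = (t - (t1 + t2) / 2) / d.
  by rewrite /l /d; field; rewrite subr_eq0 gt_eqF.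
have lr : `|l - 2^-1| <= r / d.
  by rewrite lE normrM normfV (gtr0_norm d0) ler_pM2r ?invr_gt0.
have l01 : 0 <= l <= 1.
  have : r / d <= 2^-1 by rewrite ler_pdivrMr // mulrC.
  by move: lr; rewrite ler_norml => /andP[? ?] ?; apply/andP; split; lra.
have Va := cA _ _ l Aa1 Aa2 l01; have Vb := cA _ _ l Ab1 Ab2 l01.
rewrite /= -tl in Va Vb; apply: (convex2_vertical cA Va Vb).
have ba : `|(l - 2^-1) * (a2 - a1)| <= (r / d) * K.
  by rewrite normrM ler_pM // /K lerDl.
have bb : `|(l - 2^-1) * (b2 - b1)| <= (r / d) * K.
  by rewrite normrM ler_pM // /K lerDr.
move: ba bb sr rw; rewrite /w !ler_norml; move: (r / d * K) => c.
move=> /andP[? ?] /andP[? ?] /andP[? ?] ?.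
apply/andP; split; lra.
Qed.

(** [lo] and [up] are the extreme values of the second coordinate on the compact slice over [t].
    Where the slice is empty the premise fails and their values are arbitrary. *)
Lemma compact_convex2_sections (R : realType) (Om : set (R * R)) :
  compact Om -> convex2 Om ->
  exists lo up : R -> R, forall t s0, Om (t, s0) ->
    forall s, Om (t, s) <-> lo t <= s <= up t.
Proof.
move=> cO vO.
suff /choice[f Hf] : forall t, exists lu : R * R, forall s0, Om (t, s0) ->
    forall s, Om (t, s) <-> lu.1 <= s <= lu.2.
  by exists (fun t => (f t).1), (fun t => (f t).2) => t; exact: Hf.
move=> t; have [[s0 Os0]|nO] := pselect (exists s, Om (t, s)); last first.
  by exists (0, 0) => s Os; exfalso; apply: nO; exists s.
pose S := [set x : R * R | Om x /\ x.1 = t].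
have cS : compact S.
  apply: (@subclosed_compact _ _ Om) => //; last by move=> x [].
  apply: closedI; first by apply: compact_closed => //; exact: norm_hausdorff.
  apply: (@closed_comp _ _ (fun x : R * R => x.1) [set u | u = t]).
    by move=> x _; exact: cvg_fst.
  exact: closed_eq.
have S0 : S !=set0 by exists (t, s0).
have c2 : {within S, continuous (fun x : R * R => x.2)}.
  by apply: continuous_subspaceT => x; exact: cvg_snd.
have [[t1 a] + Ha] := compact_EVT_min S0 cS c2.
have [[t2 b] + Hb] := compact_EVT_max S0 cS c2.
rewrite !inE => -[Ob /= t2E] [Oa /= t1E]; subst t1 t2.
exists (a, b) => s1 Os1 s /=; split => [Os|]; last exact: convex2_vertical.
by apply/andP; split; [apply: (Ha (t, s))|apply: (Hb (t, s))]; rewrite inE.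
Qed.

Lemma compact2_bounded (R : realType) (Om : set (R * R)) : compact Om ->
  exists B : R, 0 < B /\ forall x, Om x -> `|x.1| <= B /\ `|x.2| <= B.
Proof.
move=> cO; have [M [_ HM]] := compact_bounded cO.
exists (`|M| + 1); split; first by rewrite ltr_wpDl.
move=> x Ox; have : `|x| <= `|M| + 1.
  by apply: HM => //; rewrite ltr_pwDr // ler_norm.
by rewrite prod_normE ge_max => /andP.
Qed.

Section Sections.
Context (R : realType) (Om : set (R * R)) (n : nat) (y : 'I_n.+1 -> R * R).
Context (yh : forall i j, i != j -> (y i).2 != (y j).2).
Context (Om_measurable : measurable (Om : set (measurableTypeR R * measurableTypeR R))).
Context (Om_fin : (leb2 Om < +oo)%E).
Context (lo up : R -> R) (B : R) (B0 : 0 < B).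
Context (Om_section : forall t s0, Om (t, s0) ->
    forall s, Om (t, s) <-> lo t <= s <= up t).
Context (Om_bounded : forall x, Om x -> `|x.1| <= B /\ `|x.2| <= B).
Implicit Types (p q : 'rV[R]_n.+1) (e t : R) (i j : 'I_n.+1) (x : R * R).
Local Notation C := (cell Om y).
Local Notation h := (shifted_cost y).
Local Notation tie := (tie y).

(** A point [y j] higher than [y i] bounds the cell of [i] from above on the line, a lower one from
    below; [up t] and [lo t] account for [Om]. Nothing forces the top above the bottom: otherwise
    the section is empty. *)
Definition cell_top p e i t : R :=
  \big[Num.min/up t]_(j | (y i).2 < (y j).2) tie p e i j t.

Definition cell_bottom p e i t : R :=
  \big[Num.max/lo t]_(j | (y j).2 < (y i).2) tie p e i j t.

Lemma cell_section p e i t s0 s : Om (t, s0) ->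
  C p e i (t, s) <-> cell_bottom p e i t <= s <= cell_top p e i t.
Proof.
move=> Os0; rewrite cellP (Om_section Os0); split.
  move=> [/andP[los sup] H]; apply/andP; split.
    by apply/bigmax_leP; split => // j ji; have := H j; rewrite le_shifted_cost_below.
  by apply/bigmin_geP; split => // j ji; have := H j; rewrite le_shifted_cost_above.
move=> /andP[/bigmax_leP[los H1] /bigmin_geP[sup H2]]; rewrite los sup; split => // j.
have [ji|ij|bij] := ltgtP (y j).2 (y i).2.
- by rewrite le_shifted_cost_below //; exact: H1.
- by rewrite le_shifted_cost_above //; exact: H2.
- have [->//|/yh] := eqVneq i j.
  by rewrite bij eqxx.
Qed.

Definition section_length p e i t : R :=
  fine (@lebesgue_measure R (xsection (C p e i) t)).

Lemma section_lengthE p e i t s0 : Om (t, s0) ->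
  section_length p e i t = Num.max 0 (cell_top p e i t - cell_bottom p e i t).
Proof.
move=> Os0; rewrite /section_length.
rewrite (_ : xsection _ t = [set` `[cell_bottom p e i t, cell_top p e i t]]).
  rewrite lebesgue_measure_itv /= lte_fin; case: ltP => [lt|le] /=.
    by rewrite max_r // subr_ge0 ltW.
  by rewrite max_l // subr_le0.
apply/seteqP; split => s; rewrite /= in_itv /=.
  by move=> /xsectionP; rewrite (cell_section _ _ _ _ Os0).
by move=> H; apply/xsectionP; rewrite (cell_section _ _ _ _ Os0).
Qed.

Lemma section_length_out p e i t : ~ (exists s, Om (t, s)) ->
  section_length p e i t = 0.
Proof.
move=> nO; rewrite /section_length (_ : xsection _ t = set0) ?measure0 //.
by apply/seteqP; split => // s /xsectionP /cellP[Os _]; apply: nO; exists s.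
Qed.

Lemma section_length_ge0 p e i t : 0 <= section_length p e i t.
Proof. exact: fine_ge0. Qed.

Lemma section_length_EFin p e i t :
  (section_length p e i t)%:E = @lebesgue_measure R (xsection (C p e i) t).
Proof.
rewrite fineK // ge0_fin_numE //.
apply: (@le_lt_trans _ _ (@lebesgue_measure R [set` `[- B, B]])); last first.
  by rewrite lebesgue_measure_itv /= lte_fin; case: ifP => _ //; rewrite -EFinD ltry.
apply: le_measure; rewrite ?inE //.
  by apply: measurable_xsection; exact: measurable_cell.
move=> s /xsectionP /cellP[/Om_bounded[_ /=]].
by rewrite ler_norml in_itv.
Qed.

Lemma measurable_section_length p e i :
  measurable_fun [set: measurableTypeR R] (section_length p e i).
Proof.
apply/measurable_EFinP; rewrite (_ : _ \o _ = (@lebesgue_measure R) \o xsection (C p e i)).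
  by apply: measurable_fun_xsection; exact: measurable_cell.
by apply/funext => t /=; rewrite section_length_EFin.
Qed.

Lemma leb2_cell_fin p e i : (leb2 (C p e i) < +oo)%E.
Proof.
apply: le_lt_trans Om_fin; apply: le_measure; rewrite ?inE //.
  exact: measurable_cell.
by move=> x [].
Qed.

Lemma integrable_section_length p e i :
  (@lebesgue_measure R).-integrable [set: measurableTypeR R] (EFin \o section_length p e i).
Proof.
apply/integrableP; split; first by apply/measurable_EFinP; exact: measurable_section_length.
apply: le_lt_trans (leb2_cell_fin p e i); rewrite /leb2 /product_measure1.
under eq_integral => t _ do rewrite /= ger0_norm ?section_length_ge0 // section_length_EFin.
exact: lexx.
Qed.

(** Fubini over the bounded range of abscissae. The removable null set [N] will hold the lines on
    which the length is not locally affine. *)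
Lemma area_section_length (N : set (measurableTypeR R)) p e i :
  measurable N -> @lebesgue_measure R N = 0%E ->
  area (C p e i) = \int[@lebesgue_measure R]_(t in [set` `[- B, B]] `\` N) section_length p e i t.
Proof.
move=> mN N0; rewrite /area /Rintegral; congr fine.
have mf := measurable_section_length p e i.
rewrite -ge0_negligible_integral //; last 2 first.
- by apply/measurable_EFinP; exact: measurable_funTS.
- by move=> t _; rewrite lee_fin section_length_ge0.
rewrite [RHS]integral_mkcond /leb2 /product_measure1.
apply: eq_integral => t _; rewrite patchE.
case: ifPn => [_|]; first by rewrite section_length_EFin.
rewrite notin_setE /= in_itv /= => tB.
rewrite -section_length_EFin section_length_out // => -[s /Om_bounded[/=]].
by rewrite ler_norml.
Qed.

Lemma integrable_section_length_on (D : set (measurableTypeR R)) p e i : measurable D ->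
  (@lebesgue_measure R).-integrable D (EFin \o section_length p e i).
Proof. by move=> mD; apply: integrableS (integrable_section_length p e i). Qed.

End Sections.

(** * Locally affine functions and differentiation under the integral sign *)

Section LocallyAffine.
Context (R : realType) (m : nat).
Implicit Types (f g : 'rV[R]_m -> R -> R) (p q : 'rV[R]_m) (e r : R).

Definition linear_form (a : 'I_m -> R) (b : R) p e : R :=
  \sum_j a j * p ord0 j + b * e.

Definition param_close r p q e e' : Prop :=
  (forall j, `|p ord0 j - q ord0 j| <= r) /\ `|e - e'| <= r.

(** Stronger than differentiability, but stable under minimum and maximum as soon as the compared
    values differ at the base point. *)
Definition locally_affine f p0 e0 : Prop :=
  exists a b rho, 0 < rho /\ forall p e, param_close rho p p0 e e0 ->
    f p e = f p0 e0 + linear_form a b (p - p0) (e - e0).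

(** The radius [r] is any bound on the increments and not their norm; later arguments plug in
    multiples of [|e - e0|] or of a step length. *)
Definition frechet f p0 e0 a b : Prop :=
  forall eta, 0 < eta -> exists rho, 0 < rho /\
    forall r p e, 0 < r <= rho -> param_close r p p0 e e0 ->
      `|f p e - f p0 e0 - linear_form a b (p - p0) (e - e0)| <= eta * r.

Lemma param_close_le r r' p q e e' : r <= r' ->
  param_close r p q e e' -> param_close r' p q e e'.
Proof. by move=> rr [H1 H2]; split=> [j|]; [exact: le_trans (H1 j) rr|exact: le_trans H2 rr]. Qed.

Lemma linear_formB a b a' b' p e :
  linear_form (fun j => a j - a' j) (b - b') p e =
  linear_form a b p e - linear_form a' b' p e.
Proof.
rewrite /linear_form opprD addrACA -mulrBl -sumrB; congr (_ + _).
by apply: eq_bigr => j _; rewrite mulrBl.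
Qed.

Lemma linear_form_le a b p q e e' r : param_close r p q e e' ->
  `|linear_form a b (p - q) (e - e')| <= (\sum_j `|a j| + `|b|) * r.
Proof.
move=> [H1 H2]; rewrite /linear_form mulrDl (le_trans (ler_normD _ _)) // lerD //.
  rewrite (le_trans (ler_norm_sum _ _ _)) // mulr_suml ler_sum // => j _.
  by rewrite !mxE normrM ler_wpM2l // H1.
by rewrite normrM ler_wpM2l.
Qed.

Lemma locally_affine_near f p0 e0 eta : 0 < eta -> locally_affine f p0 e0 ->
  exists rho, 0 < rho /\ forall p e, param_close rho p p0 e e0 ->
    `|f p e - f p0 e0| < eta.
Proof.
move=> eta0 [a [b [rho [rho0 H]]]].
pose K := \sum_j `|a j| + `|b| + 1.
have K0 : 0 < K by rewrite ltr_pwDr // addr_ge0 // sumr_ge0.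
exists (Num.min rho (eta / 2 / K)); split; first by rewrite lt_min rho0 !divr_gt0.
move=> p e c; have c1 : param_close rho p p0 e e0 by apply: param_close_le c; rewrite ge_min lexx.
have c2 : param_close (eta / 2 / K) p p0 e e0 by apply: param_close_le c; rewrite ge_min lexx orbT.
rewrite (H _ _ c1) addrC addKr (le_lt_trans (linear_form_le _ _ c2)) //.
apply: (@le_lt_trans _ _ (K * (eta / 2 / K))).
  by rewrite ler_wpM2r ?divr_ge0 ?ltW // /K; lra.
by rewrite mulrC divfK ?gt_eqF //; lra.
Qed.

Lemma locally_affine_cst c p0 e0 : locally_affine (fun _ _ => c) p0 e0.
Proof.
exists (fun=> 0), 0, 1; split => // p e _; rewrite /linear_form big1 ?mul0r ?addr0 // => j _.
by rewrite mul0r.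
Qed.

Lemma locally_affineB f g p0 e0 : locally_affine f p0 e0 -> locally_affine g p0 e0 ->
  locally_affine (fun p e => f p e - g p e) p0 e0.
Proof.
move=> [a [b [rho [rho0 H]]]] [a' [b' [rho' [rho'0 H']]]].
exists (fun j => a j - a' j), (b - b'), (Num.min rho rho'); split; first by rewrite lt_min rho0.
move=> p e c; rewrite linear_formB (H p e) ?(H' p e); first by ring.
  by apply: param_close_le c; rewrite ge_min lexx orbT.
by apply: param_close_le c; rewrite ge_min lexx.
Qed.

Lemma locally_affine_eq_near f g p0 e0 rho : 0 < rho ->
  (forall p e, param_close rho p p0 e e0 -> g p e = f p e) ->
  locally_affine f p0 e0 -> locally_affine g p0 e0.
Proof.
move=> rho0 E [a [b [rho' [rho'0 H]]]].
exists a, b, (Num.min rho rho'); split; first by rewrite lt_min rho0.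
move=> p e c.
have c1 : param_close rho p p0 e e0 by apply: param_close_le c; rewrite ge_min lexx.
have c2 : param_close rho' p p0 e e0 by apply: param_close_le c; rewrite ge_min lexx orbT.
have c0 : param_close rho p0 p0 e0 e0 by split => [j|]; rewrite subrr normr0 ltW.
by rewrite (E _ _ c1) (E _ _ c0) (H _ _ c2).
Qed.

Lemma locally_affine_lt f g p0 e0 : locally_affine f p0 e0 -> locally_affine g p0 e0 ->
  f p0 e0 < g p0 e0 -> exists rho, 0 < rho /\ forall p e, param_close rho p p0 e e0 ->
    f p e < g p e.
Proof.
move=> lf lg fg; have fg0 : 0 < g p0 e0 - f p0 e0 by rewrite subr_gt0.
have [rho [rho0 H]] := locally_affine_near fg0 (locally_affineB lg lf).
exists rho; split => // p e /H; rewrite ltr_norml => /andP[? ?]; lra.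
Qed.

Lemma locally_affine_min f g p0 e0 : f p0 e0 != g p0 e0 ->
  locally_affine f p0 e0 -> locally_affine g p0 e0 ->
  locally_affine (fun p e => Num.min (f p e) (g p e)) p0 e0.
Proof.
rewrite neq_lt => /orP[] fg lf lg.
  have [rho [rho0 H]] := locally_affine_lt lf lg fg.
  apply: (locally_affine_eq_near rho0 _ lf) => p e /H pe.
  by rewrite min_l // ltW.
have [rho [rho0 H]] := locally_affine_lt lg lf fg.
apply: (locally_affine_eq_near rho0 _ lg) => p e /H pe.
by rewrite min_r // ltW.
Qed.

Lemma locally_affine_max f g p0 e0 : f p0 e0 != g p0 e0 ->
  locally_affine f p0 e0 -> locally_affine g p0 e0 ->
  locally_affine (fun p e => Num.max (f p e) (g p e)) p0 e0.
Proof.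
rewrite neq_lt => /orP[] fg lf lg.
  have [rho [rho0 H]] := locally_affine_lt lf lg fg.
  apply: (locally_affine_eq_near rho0 _ lg) => p e /H pe.
  by rewrite max_r // ltW.
have [rho [rho0 H]] := locally_affine_lt lg lf fg.
apply: (locally_affine_eq_near rho0 _ lf) => p e /H pe.
by rewrite max_l // ltW.
Qed.

(** One statement for minimum and maximum. That the folded value is [u] or one of the [F j] is
    carried along because it shows, in the induction and in later uses, that the next two values to
    be compared are distinct. *)
Lemma locally_affine_big (op : R -> R -> R) (J : finType) (P : pred J)
    (u : R) (F : J -> 'rV[R]_m -> R -> R) p0 e0 :
  (forall x z, op x z = x \/ op x z = z) ->
  (forall f g, f p0 e0 != g p0 e0 -> locally_affine f p0 e0 -> locally_affine g p0 e0 ->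
    locally_affine (fun p e => op (f p e) (g p e)) p0 e0) ->
  (forall j, P j -> locally_affine (F j) p0 e0) ->
  (forall j, P j -> F j p0 e0 != u) ->
  (forall j k, P j -> P k -> j != k -> F j p0 e0 != F k p0 e0) ->
  locally_affine (fun p e => \big[op/u]_(j | P j) F j p e) p0 e0 /\
  (\big[op/u]_(j | P j) F j p0 e0 = u \/
   exists2 j, P j & \big[op/u]_(j | P j) F j p0 e0 = F j p0 e0).
Proof.
move=> op_or op_la laF Fu Fd.
suff H (s : seq J) : uniq s ->
    locally_affine (fun p e => \big[op/u]_(j <- s | P j) F j p e) p0 e0 /\
    (\big[op/u]_(j <- s | P j) F j p0 e0 = u \/
     exists j, [/\ j \in s, P j & \big[op/u]_(j <- s | P j) F j p0 e0 = F j p0 e0]).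
  have [la1 V] := H _ (index_enum_uniq J); split => //.
  by case: V => [|[j [_ ? ?]]]; [left|right; exists j].
elim: s => [|i s IH] /=.
  move=> _; rewrite big_nil; split; last by left.
  by under eq_fun do under eq_fun do rewrite big_nil; exact: locally_affine_cst.
move=> /andP[si /IH[la1 V]].
have [Pi|nPi] := boolP (P i); last first.
  rewrite big_cons (negbTE nPi); split.
    by under eq_fun do under eq_fun do rewrite big_cons (negbTE nPi).
  by case: V => [|[j [sj ? ?]]]; [left|right; exists j; split => //; rewrite inE sj orbT].
have Fi : F i p0 e0 != \big[op/u]_(j <- s | P j) F j p0 e0.
  case: V => [->|[j [sj Pj ->]]]; first exact: Fu.
  by apply: Fd => //; apply: contraNneq si => ->.
split.
  under eq_fun do under eq_fun do rewrite big_cons Pi.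
  by apply: op_la => //; exact: laF.
rewrite big_cons Pi.
case: (op_or (F i p0 e0) (\big[op/u]_(j <- s | P j) F j p0 e0)) => ->.
  by right; exists i; rewrite inE eqxx.
by case: V => [|[j [sj ? ?]]]; [left|right; exists j; split => //; rewrite inE sj orbT].
Qed.

End LocallyAffine.

Section DifferentiationUnderIntegral.
Context d (T : measurableType d) (R : realType) (mu : {measure set T -> \bar R}).
Context (D : set T) (mD : measurable D) (Dfin : (mu D < +oo)%E).
Context (m : nat) (g : T -> 'rV[R]_m -> R -> R) (p0 : 'rV[R]_m) (e0 : R) (K : R).
Context (g_int : forall p e, mu.-integrable D (EFin \o (fun t => g t p e))).
Context (g_lip : forall t r p e, D t -> param_close r p p0 e e0 ->
  `|g t p e - g t p0 e0| <= K * r).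
Context (g_la : forall t, D t -> locally_affine (g t) p0 e0).

Let mg p e : measurable_fun D (fun t => g t p e).
Proof. by apply/measurable_EFinP; have /integrableP[] := g_int p e. Qed.

Let bounded_integrable (f : T -> R) (M : R) : measurable_fun D f ->
  (forall t, D t -> `|f t| <= M) -> mu.-integrable D (EFin \o f).
Proof.
move=> mf bf; apply: measurable_bounded_integrable => //.
exists M; split; first exact: num_real.
by move=> x Mx t Dt; apply: le_trans (bf t Dt) (ltW Mx).
Qed.

(* A coefficient of the affine expansion is the limit of difference quotients
   along any direction in which the linear form is that coefficient. *)
Let coefficient (c : T -> R) (v : 'rV[R]_m) (w : R) :
  (forall j, `|v ord0 j| <= 1) -> `|w| <= 1 ->
  (forall t, D t -> exists rho, 0 < rho /\ forall k, 0 < k <= rho ->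
     g t (p0 + k *: v) (e0 + k * w) - g t p0 e0 = k * c t) ->
  measurable_fun D c /\ forall t, D t -> `|c t| <= K.
Proof.
move=> v1 w1 H; split.
  apply: (@measurable_fun_cvg _ _ _ _ (fun k t => k.+1%:R *
    (g t (p0 + k.+1%:R^-1 *: v) (e0 + k.+1%:R^-1 * w) - g t p0 e0))).
    move=> k; apply: measurable_funM; first exact: measurable_cst.
    exact: measurable_funB.
  move=> t Dt; have [rho [rho0 Hr]] := H t Dt.
  apply: cvg_near_cst; near=> k.
  rewrite Hr ?mulVKf ?pnatr_eq0 // invr_gt0 ltr0Sn /=.
  near: k; have [k0] := ltr_add_invr rho0; rewrite add0r => Hk0.
  exists k0 => // k /= kk0; apply: le_trans (ltW Hk0).
  by rewrite lef_pV2 ?posrE ?ltr0Sn // ler_nat.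
move=> t Dt; have [rho [rho0 Hr]] := H t Dt.
rewrite -(ler_pM2l rho0) (mulrC rho K) -[X in X * `|_|](gtr0_norm rho0) -normrM -Hr ?rho0 ?lexx //.
apply: g_lip => //; split => [j|].
  rewrite !mxE addrAC subrr add0r normrM (gtr0_norm rho0) -[leRHS]mulr1.
  by rewrite ler_wpM2l ?v1 // ltW.
by rewrite addrAC subrr add0r normrM (gtr0_norm rho0) -[leRHS]mulr1 ler_wpM2l // ltW.
Unshelve. all: by end_near. Qed.

(** The pointwise coefficients are picked by choice; [coefficient] makes them measurable and bounded
    by [K], so that they can be integrated. For each [t] the remainder vanishes identically near
    [(p0, e0)], but on a neighbourhood that depends on [t]; dominated convergence replaces the
    missing uniformity. *)
Lemma frechet_integral : exists a b,
  frechet (fun p e => \int[mu]_(t in D) g t p e) p0 e0 a b.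
Proof.
have /choice[al Hal] : forall t, exists ab : ('I_m -> R) * R, D t ->
    exists rho, 0 < rho /\ forall p e, param_close rho p p0 e e0 ->
    g t p e = g t p0 e0 + linear_form ab.1 ab.2 (p - p0) (e - e0).
  move=> t; have [Dt|nDt] := pselect (D t); last by exists (fun=> 0, 0).
  by have [a [b H]] := g_la Dt; exists (a, b).
have cst_close (k rho : R) (v : 'rV[R]_m) (w : R) :
    (forall j, `|v ord0 j| <= 1) -> `|w| <= 1 -> 0 < k <= rho ->
    param_close rho (p0 + k *: v) p0 (e0 + k * w) e0.
  move=> v1 w1 /andP[k0 kr]; split => [j|].
    by rewrite !mxE addrAC subrr add0r normrM (gtr0_norm k0) (le_trans _ kr) // ger_pMr.
  by rewrite addrAC subrr add0r normrM (gtr0_norm k0) (le_trans _ kr) // ger_pMr.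
have Ha j : measurable_fun D (fun t => (al t).1 j) /\ forall t, D t -> `|(al t).1 j| <= K.
  have dj k : `|(delta_mx ord0 j : 'rV[R]_m) ord0 k| <= 1.
    by rewrite mxE eqxx /=; case: eqP; rewrite ?normr1 ?normr0.
  apply: (@coefficient _ (delta_mx ord0 j) 0) => //; first by rewrite normr0.
  move=> t Dt; have [rho [rho0 H]] := Hal t Dt; exists rho; split => // k k01.
  rewrite H; last by apply: cst_close => //; rewrite normr0.
  rewrite addrAC subrr add0r /linear_form mulr0 addr0 subrr mulr0 addr0.
  rewrite (bigD1 j) //= big1 => [|i ij].
    by rewrite addr0 !mxE !eqxx addrAC subrr add0r mulr1 mulrC.
  by rewrite !mxE eqxx (negbTE ij) /= mulr0 addr0 subrr mulr0.
have Hb : measurable_fun D (fun t => (al t).2) /\ forall t, D t -> `|(al t).2| <= K.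
  apply: (@coefficient _ 0 1) => //; [by move=> j; rewrite mxE normr0|by rewrite normr1|].
  move=> t Dt; have [rho [rho0 H]] := Hal t Dt; exists rho; split => // k k01.
  rewrite H; last by apply: cst_close => //; [move=> j; rewrite mxE normr0|rewrite normr1].
  rewrite addrAC subrr add0r /linear_form big1 => [|i _]; last first.
    by rewrite !mxE mulr0 addr0 subrr mulr0.
  by rewrite add0r mulr1 (addrC e0) addrK mulrC.
have Ia j : mu.-integrable D (EFin \o (fun t => (al t).1 j)).
  by have [? ?] := Ha j; exact: (@bounded_integrable _ K).
have Ib : mu.-integrable D (EFin \o (fun t => (al t).2)).
  by have [? ?] := Hb; exact: (@bounded_integrable _ K).
pose a j := \int[mu]_(t in D) (al t).1 j.
pose b := \int[mu]_(t in D) (al t).2.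
have IZ (f : T -> R) c : mu.-integrable D (EFin \o f) ->
    mu.-integrable D (EFin \o (fun t => f t * c)).
  by move=> If; rewrite (_ : _ \o _ = (fun t => c%:E * (f t)%:E)%E);
    [exact: integrableZl|apply/funext => t /=; rewrite -EFinM mulrC].
have Isum (s : seq 'I_m) (p : 'rV[R]_m) :
    mu.-integrable D (EFin \o (fun t => \sum_(j <- s) (al t).1 j * p ord0 j)) /\
    \int[mu]_(t in D) (\sum_(j <- s) (al t).1 j * p ord0 j) = \sum_(j <- s) a j * p ord0 j.
  elim: s => [|j s [I1 E1]].
    split; last by under eq_Rintegral do rewrite big_nil; rewrite Rintegral_cst // mul0r big_nil.
    under eq_fun do rewrite big_nil.
    by apply: (bounded_integrable (M := 0)) => // t _; rewrite normr0.
  split; under eq_fun do rewrite big_cons.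
    by apply: (integrableD mD (IZ _ _ (Ia j)) I1).
  by rewrite RintegralD //; [rewrite big_cons E1 RintegralZr|exact: IZ].
have Il (p : 'rV[R]_m) (e : R) :
    mu.-integrable D (EFin \o (fun t => linear_form (al t).1 (al t).2 p e)) /\
    \int[mu]_(t in D) linear_form (al t).1 (al t).2 p e = linear_form a b p e.
  have [I1 E1] := Isum (index_enum 'I_m) p.
  split; first exact: (integrableD mD I1 (IZ _ _ Ib)).
  by rewrite /linear_form RintegralD //; [rewrite E1 RintegralZr|exact: IZ].
exists a, b => eta eta0; apply: contrapT => nrho.
(* A sequence that violates the expansion with tolerance [eta] and radii tending to 0; the integrals
   of the normalised remainders [dq k] tend to 0 and contradict it. *)
have /choice[s Hs] : forall k : nat, exists s : R * 'rV[R]_m * R,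
    [/\ 0 < s.1.1 <= k.+1%:R^-1, param_close s.1.1 s.1.2 p0 s.2 e0 &
      eta * s.1.1 < `|\int[mu]_(t in D) g t s.1.2 s.2 - \int[mu]_(t in D) g t p0 e0 -
        linear_form a b (s.1.2 - p0) (s.2 - e0)|].
  move=> k; apply: contrapT => nk; apply: nrho.
  exists k.+1%:R^-1; split => // r p e r0 c; rewrite leNgt; apply/negP => lt.
  by apply: nk; exists (r, p, e).
pose dq k t : R := (g t (s k).1.2 (s k).2 - g t p0 e0 -
  linear_form (al t).1 (al t).2 ((s k).1.2 - p0) ((s k).2 - e0)) * (s k).1.1^-1.
have Idq k : mu.-integrable D (EFin \o dq k).
  apply: IZ.
  exact: (integrableB mD (integrableB mD (g_int _ _) (g_int p0 e0)) (Il _ _).1).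
have Edq k : \int[mu]_(t in D) dq k t =
    (\int[mu]_(t in D) g t (s k).1.2 (s k).2 - \int[mu]_(t in D) g t p0 e0 -
        linear_form a b ((s k).1.2 - p0) ((s k).2 - e0)) * (s k).1.1^-1.
  have I1 := integrableB mD (g_int (s k).1.2 (s k).2) (g_int p0 e0).
  have [I2 E2] := Il ((s k).1.2 - p0) ((s k).2 - e0).
  rewrite RintegralZr //; last exact: (integrableB mD I1 I2).
  by rewrite RintegralB // E2 RintegralB.
(* The first [K] bounds the normalised increment of [g], the rest the linear form, whose [m + 1]
   coefficients are at most [K] in absolute value. *)
pose M : R := K + (\sum_(j < m) K + K).
have dq_le k t : D t -> `|dq k t| <= M.
  move=> Dt; have [/andP[r0 _] cl _] := Hs k.
  rewrite normrM normfV (gtr0_norm r0) ler_pdivrMr // (le_trans (ler_normB _ _)) //.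
  rewrite /M mulrDl lerD ?g_lip // (le_trans (linear_form_le _ _ cl)) //.
  apply: ler_wpM2r; first exact: ltW.
  apply: lerD; last exact: Hb.2.
  by apply: ler_sum => j _; exact: (Ha j).2.
have dq_cvg t : D t -> dq k t @[k --> \oo] --> 0.
  move=> Dt; have [rho [rho0 H]] := Hal t Dt.
  apply: cvg_near_cst; near=> k.
  have [/andP[r0 rk] cl _] := Hs k.
  rewrite /dq (H (s k).1.2 (s k).2).
    by rewrite (addrC (g t p0 e0)) addrK subrr mul0r.
  apply: param_close_le cl; apply: le_trans rk _.
  near: k; have [k0] := ltr_add_invr rho0; rewrite add0r => Hk0.
  exists k0 => // k /= kk0; apply: le_trans (ltW Hk0).
  by rewrite lef_pV2 ?posrE ?ltr0Sn // ler_nat.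
have edq_cvg t : D t -> (fun k => (EFin \o dq k) t) @ \oo --> 0%E.
  by move=> Dt; apply: cvg_EFin; [exact: nearW|exact: dq_cvg].
have [_ _] := @dominated_convergence _ _ _ mu D mD (fun k => EFin \o dq k) (cst 0%E)
  (EFin \o cst M) (fun k => measurable_int mu (Idq k)) (measurable_cst _)
  (aeW _ edq_cvg)
  (@bounded_integrable (cst M) `|M| (measurable_cst _) (fun t _ => lexx _))
  (aeW _ (fun t k Dt => dq_le k t Dt)).
rewrite integral0 => /fine_cvg /= /cvgrPdist_lt /(_ _ eta0) [k _ /(_ k (leqnn k))] /=.
rewrite sub0r normrN -[X in `|X|]/(\int[mu]_(t in D) dq k t) Edq.
have [/andP[r0 _] _ lt] := Hs k.
by rewrite normrM normfV (gtr0_norm r0) ltr_pdivrMr // ltNge ltW.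
Unshelve. all: by end_near. Qed.

End DifferentiationUnderIntegral.

(** * Differentiability of the cell areas *)

(** There is at most one zero on each side of [c]: a zero strictly between [c] and another zero
    would be a convex combination of the two, and concavity would make the value there positive. *)
Lemma concave_zeros (R : realType) (T : set R) (f : R -> R) (c : R) :
  (forall t u l, T t -> T u -> 0 <= l <= 1 ->
    (1 - l) * f t + l * f u <= f ((1 - l) * t + l * u)) ->
  T c -> 0 < f c ->
  exists x1 x2, forall t, T t -> f t = 0 -> t = x1 \/ t = x2.
Proof.
move=> conc Tc fc.
have mid u v w : T u -> T v -> 0 < f u -> f v = 0 -> f w = 0 ->
    ~ (u < w < v \/ v < w < u).
  move=> Tu Tv fu fv fw uwv.
  have uv : v - u != 0 by rewrite subr_eq0; apply/eqP => E; case: uwv; lra.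
  have := conc _ _ ((w - u) / (v - u)) Tu Tv.
  rewrite (_ : _ + _ * v = w); last by field.
  rewrite fv fw mulr0 addr0.
  have : 0 < 1 - (w - u) / (v - u) /\ 0 <= (w - u) / (v - u).
    have -> : 1 - (w - u) / (v - u) = (v - w) / (v - u) by field.
    case: uwv => /andP[? ?].
      by rewrite divr_gt0 ?divr_ge0 //; lra.
    have nn (a b : R) : a / b = (- a) / (- b) by rewrite invrN mulrNN.
    rewrite (nn (v - w)) (nn (w - u)).
    by rewrite divr_gt0 ?divr_ge0 //; lra.
  move: (_ / _) => l [l1 l0] H; have := mulr_gt0 l1 fu; rewrite ltNge H //.
  by apply/andP; split; lra.
have side (S : R -> Prop) : exists x, forall t, T t -> f t = 0 -> S t ->
    t = x \/ exists u, [/\ S u, T u, f u = 0 & u <> t].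
  have [[x [Tx fx Sx]]|nx] := pselect (exists x, [/\ T x, f x = 0 & S x]).
    exists x => t Tt ft St; have [->|/eqP tx] := eqVneq t x; [by left|right].
    by exists x; split => //; exact: nesym.
  by exists 0 => t Tt ft St; exfalso; apply: nx; exists t.
have [x1 H1] := side (fun t => c < t); have [x2 H2] := side (fun t => t < c).
exists x1, x2 => t Tt ft.
have [tc|ct|E] := ltgtP t c; last by rewrite E in ft; rewrite ft ltxx in fc.
  have [|[u [uc Tu fu /eqP ut]]] := H2 t Tt ft tc; first by right.
  exfalso; move: ut; rewrite neq_lt => /orP[ut|tu].
    by apply: (mid c u t) => //; right; rewrite ut.
  by apply: (mid c t u) => //; right; rewrite tu.
have [|[u [uc Tu fu /eqP ut]]] := H1 t Tt ft ct; first by left.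
exfalso; move: ut; rewrite neq_lt => /orP[ut|tu].
  by apply: (mid c t u) => //; left; rewrite uc.
by apply: (mid c u t) => //; left; rewrite ct.
Qed.

(** The containing set is finite, hence measurable and null, whatever the form of [P]; finite
    disjunctions preserve the property. *)
Definition thin (R : realType) (P : R -> Prop) : Prop :=
  exists N : set R, finite_set N /\ forall t, P t -> N t.

Lemma thin_pair (R : realType) (P : R -> Prop) x1 x2 :
  (forall t, P t -> t = x1 \/ t = x2) -> thin P.
Proof. by move=> H; exists [set x1; x2]; split => // t /H. Qed.

Lemma thinW (R : realType) (P Q : R -> Prop) : (forall t, P t -> Q t) -> thin Q -> thin P.
Proof. by move=> PQ [N [fN H]]; exists N; split => // t /PQ /H. Qed.

Lemma thin_or (R : realType) (P Q : R -> Prop) : thin P -> thin Q -> thin (fun t => P t \/ Q t).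
Proof.
move=> [N [fN H]] [M [fM H']]; exists (N `|` M); split; first by rewrite finite_setU.
by move=> t [/H|/H']; [left|right].
Qed.

Lemma thin_exists (R : realType) (J : finType) (P : J -> R -> Prop) :
  (forall j, thin (P j)) -> thin (fun t => exists j, P j t).
Proof.
move=> /choice[N HN]; exists (\bigcup_(j in [set: J]) N j); split.
  by apply: bigcup_finite => // j _; exact: (HN j).1.
by move=> t [j /(HN j).2 Nj]; exists j.
Qed.

Lemma thin_and (R : realType) (A : Prop) (P : R -> Prop) :
  (A -> thin P) -> thin (fun t => A /\ P t).
Proof.
move=> H; have [/H|nA] := pselect A; first by apply: thinW => t [].
by exists set0; split => // t [].
Qed.

Section AreaDifferentiability.
Context (R : realType) (Om : set (R * R)) (n : nat) (y : 'I_n.+1 -> R * R).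
Context (yh : forall i j, i != j -> (y i).2 != (y j).2).
Context (Om_measurable : measurable (Om : set (measurableTypeR R * measurableTypeR R))).
Context (Om_fin : (leb2 Om < +oo)%E) (Om_convex : convex2 Om).
Context (lo up : R -> R) (B : R) (B0 : 0 < B).
Context (Om_section : forall t s0, Om (t, s0) ->
    forall s, Om (t, s) <-> lo t <= s <= up t).
Context (Om_bounded : forall x, Om x -> `|x.1| <= B /\ `|x.2| <= B).
Implicit Types (p q : 'rV[R]_n.+1) (e t : R) (i j : 'I_n.+1) (x : R * R).
Local Notation C := (cell Om y).
Local Notation h := (shifted_cost y).
Local Notation tie := (tie y).

Lemma tie_linear p e p0 e0 i j t : tie p e i j t = tie p0 e0 i j t +
  linear_form (fun k => ((k == i)%:R - (k == j)%:R) / (2 * ((y j).2 - (y i).2)))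
    ((2 * t * ((y i).1 - (y j).1) - ((y i).1 ^+ 2 - (y j).1 ^+ 2)) / (2 * ((y j).2 - (y i).2)))
    (p - p0) (e - e0).
Proof.
rewrite /linear_form.
have pick (q : 'rV[R]_n.+1) k : \sum_l (l == k)%:R * q ord0 l = q ord0 k.
  rewrite (bigD1 k) //= eqxx mul1r big1 ?addr0 // => l /negbTE->.
  by rewrite mul0r.
rewrite (_ : \sum_l _ =
    ((p - p0) ord0 i - (p - p0) ord0 j) / (2 * ((y j).2 - (y i).2))); last first.
  rewrite -(pick (p - p0) i) -(pick (p - p0) j) -sumrB mulr_suml.
  by apply: eq_bigr => l _; rewrite -mulrBl; ring.
rewrite /tie !mxE; move: (2 * ((y j).2 - (y i).2))^-1 => c; ring.
Qed.

Lemma tie_lipschitz : exists K, 0 <= K /\ forall p e p0 e0 r i j t, `|t| <= B ->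
  param_close r p p0 e e0 -> `|tie p e i j t - tie p0 e0 i j t| <= K * r.
Proof.
pose Kij i j := (2 + 2 * B * `|(y i).1 - (y j).1| + `|(y i).1 ^+ 2 - (y j).1 ^+ 2|)
  * `|(2 * ((y j).2 - (y i).2))^-1|.
have Kij0 i j : 0 <= Kij i j by rewrite mulr_ge0 ?addr_ge0 ?mulr_ge0 // ltW.
exists (\sum_i \sum_j Kij i j); split; first by rewrite sumr_ge0 // => i _; rewrite sumr_ge0.
move=> p e p0 e0 r i j t tB [cp ce].
have r0 : 0 <= r by apply: le_trans ce.
apply: (@le_trans _ _ (Kij i j * r)); last first.
  rewrite ler_wpM2r // (bigD1 i) //= (bigD1 j) //= -addrA lerDl.
  by rewrite addr_ge0 ?sumr_ge0 // => k _; rewrite sumr_ge0.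
rewrite (_ : tie p e i j t - _ = ((p ord0 i - p0 ord0 i) - (p ord0 j - p0 ord0 j)
   + (e - e0) * (2 * t * ((y i).1 - (y j).1)) - (e - e0) * ((y i).1 ^+ 2 - (y j).1 ^+ 2))
   * (2 * ((y j).2 - (y i).2))^-1); last by rewrite /tie; ring.
rewrite normrM /Kij [leRHS]mulrAC ler_wpM2r //.
rewrite [leRHS](_ : _ = (r + r + 2 * B * `|(y i).1 - (y j).1| * r) +
  `|(y i).1 ^+ 2 - (y j).1 ^+ 2| * r); last by ring.
apply: (le_trans (ler_normB _ _)); apply: lerD; last first.
  by rewrite normrM mulrC ler_wpM2l.
apply: (le_trans (ler_normD _ _)); apply: lerD.
  by apply: (le_trans (ler_normB _ _)); apply: lerD.
rewrite normrM mulrC ler_pM // !normrM (ger0_norm (_ : 0 <= 2)) //.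
by rewrite ler_wpM2r // ler_wpM2l.
Qed.

(** Minimum and maximum are 1-Lipschitz for the sup norm, so top and bottom inherit the bound of the
    ties; their difference accounts for the factor 2. *)
Lemma section_length_lipschitz : exists K, 0 <= K /\ forall p e p0 e0 r i t, `|t| <= B ->
  param_close r p p0 e e0 ->
  `|section_length Om y p e i t - section_length Om y p0 e0 i t| <= K * r.
Proof.
have [K [K0 HK]] := tie_lipschitz; exists (2 * K); split; first by rewrite mulr_ge0.
move=> p e p0 e0 r i t tB cl.
have r0 : 0 <= r by case: cl => _; apply: le_trans.
have [[s0 Os0]|nO] := pselect (exists s, Om (t, s)); last first.
  by rewrite !section_length_out // subrr normr0 !mulr_ge0.
rewrite !(section_lengthE yh Om_section _ _ _ Os0).
have lipmax (a b c d k : R) : `|a - c| <= k -> `|b - d| <= k -> `|Num.max a b - Num.max c d| <= k.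
  by rewrite !ler_norml => /andP[? ?] /andP[? ?]; rewrite /Num.max; do 2 case: ifP => /= ?; lra.
have lipmin (a b c d k : R) : `|a - c| <= k -> `|b - d| <= k -> `|Num.min a b - Num.min c d| <= k.
  by rewrite !ler_norml => /andP[? ?] /andP[? ?]; rewrite /Num.min; do 2 case: ifP => /= ?; lra.
have Kr0 : 0 <= K * r by rewrite mulr_ge0.
have top : `|cell_top y up p e i t - cell_top y up p0 e0 i t| <= K * r.
  rewrite /cell_top; elim/big_ind2 : _ => [|a b c d|j _]; first by rewrite subrr normr0.
    exact: lipmin.
  exact: HK.
have bot : `|cell_bottom y lo p e i t - cell_bottom y lo p0 e0 i t| <= K * r.
  rewrite /cell_bottom; elim/big_ind2 : _ => [|a b c d|j _]; first by rewrite subrr normr0.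
    exact: lipmax.
  exact: HK.
apply: lipmax; first by rewrite subrr normr0 !mulr_ge0.
move: top bot; rewrite !ler_norml => /andP[? ?] /andP[? ?]; lra.
Qed.

Lemma area_lipschitz : exists K, 0 <= K /\ forall p e p0 e0 r i,
  param_close r p p0 e e0 -> `|area (C p e i) - area (C p0 e0 i)| <= K * r.
Proof.
have [K [K0 HK]] := section_length_lipschitz.
exists (K * (2 * B)); split; first by rewrite !mulr_ge0 // ltW.
move=> p e p0 e0 r i cl.
have r0 : 0 <= r by case: cl => _; apply: le_trans.
rewrite !(area_section_length y Om_measurable Om_bounded _ _ _ measurable0) ?measure0 //.
rewrite setD0.
have BB : - B < B by rewrite (lt_trans _ B0) // oppr_lt0.
have mD : measurable ([set` `[- B, B]] : set (measurableTypeR R)) by exact: measurable_itv.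
have I1 := integrable_section_length_on y Om_measurable Om_fin Om_bounded p e i mD.
have I2 := integrable_section_length_on y Om_measurable Om_fin Om_bounded p0 e0 i mD.
rewrite -(RintegralB mD I1 I2).
have I3 := integrableB mD I1 I2.
apply: (le_trans (le_normr_Rintegral mD I3)).
have -> : K * (2 * B) * r = \int[@lebesgue_measure R]_(t in [set` `[- B, B]]) (K * r).
  rewrite Rintegral_cst // /= lebesgue_measure_itv /= lte_fin.
  by rewrite BB /=; ring.
apply: le_Rintegral => //.
- by have /integrable_abse := I3.
- apply: measurable_bounded_integrable => //.
  + by rewrite /= lebesgue_measure_itv /= lte_fin; case: ifP => _ //; rewrite -EFinD ltry.
  + exists (K * r); split; first exact: num_real.
    by move=> M KM t _; rewrite ger0_norm ?mulr_ge0 // ltW.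
- by move=> t; rewrite /= in_itv /= -ler_norml => tB; exact: HK.
Qed.

Section Generic.
Context (p0 : 'rV[R]_n.+1) (e0 : R) (area_gt0 : forall i, 0 < area (C p0 e0 i)).

Lemma cell_box i : exists z r, 0 < r /\
  forall x, `|x.1 - z.1| <= r -> `|x.2 - z.2| <= r -> C p0 e0 i x.
Proof.
apply: convex2_box; [exact: measurable_cell|exact: convex_cell|].
have := area_gt0 i; rewrite /area.
by case: (leb2 _) => [r| |] //=; rewrite ?ltxx // lte_fin.
Qed.

Let T := [set t | exists s, Om (t, s)].

Lemma sec_top t s : Om (t, s) -> Om (t, up t) /\ lo t <= up t.
Proof.
move=> Os; have /(Om_section Os) /andP[a b] := Os.
have lu := le_trans a b; split => //.
by apply/(Om_section Os); rewrite lu lexx.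
Qed.

Lemma sec_bottom t s : Om (t, s) -> Om (t, lo t).
Proof.
move=> Os; have /(Om_section Os) /andP[a b] := Os.
by apply/(Om_section Os); rewrite lexx (le_trans a b).
Qed.

Lemma up_concave t u l : T t -> T u -> 0 <= l <= 1 ->
  (1 - l) * up t + l * up u <= up ((1 - l) * t + l * u).
Proof.
move=> [s Os] [s' Os'] l01.
have Oc := Om_convex (sec_top Os).1 (sec_top Os').1 l01.
by have /(Om_section Oc) /andP[] := Oc.
Qed.

Lemma lo_convex t u l : T t -> T u -> 0 <= l <= 1 ->
  lo ((1 - l) * t + l * u) <= (1 - l) * lo t + l * lo u.
Proof.
move=> [s Os] [s' Os'] l01.
have Oc := Om_convex (sec_bottom Os) (sec_bottom Os') l01.
by have /(Om_section Oc) /andP[] := Oc.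
Qed.

Lemma tie_affine p e i j t u l :
  tie p e i j ((1 - l) * t + l * u) = (1 - l) * tie p e i j t + l * tie p e i j u.
Proof. by rewrite /tie; ring. Qed.

(** The central line of a box inside the cell. On it [lo t], [up t] and all ties of [i] keep the
    distance [r] from [s]; such lines are where the coincidences below fail. *)
Lemma cell_vertical i : exists t s r, [/\ 0 < r, Om (t, s), lo t <= s - r, s + r <= up t &
  forall j, ((y i).2 < (y j).2 -> s + r <= tie p0 e0 i j t) /\
            ((y j).2 < (y i).2 -> tie p0 e0 i j t <= s - r)].
Proof.
have [[t s] [r [r0 H]]] := cell_box i; exists t, s, r.
have c u : - r <= u <= r -> C p0 e0 i (t, s + u).
  move=> ur; apply: H; rewrite /= ?subrr ?normr0 ?(ltW r0) //.
  by rewrite addrAC subrr add0r ler_norml.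
have /cellP[Os _] : C p0 e0 i (t, s + 0) by apply: c; lra.
rewrite addr0 in Os.
have /cellP[Ou Hu] : C p0 e0 i (t, s + r) by apply: c; lra.
have /cellP[Ol Hl] : C p0 e0 i (t, s + - r) by apply: c; lra.
split => //.
- by have /(Om_section Os) /andP[] := Ol.
- by have /(Om_section Os) /andP[] := Ou.
- move=> j; split => ij.
    by have := Hu j; rewrite (le_shifted_cost_above yh).
  by have := Hl j; rewrite (le_shifted_cost_below yh).
Qed.

(** At this height all three shifted costs agree, so a coincidence of two ties involves the three
    indices symmetrically. *)
Lemma tie_triple t i j k : i != j -> i != k -> j != k ->
  tie p0 e0 i j t = tie p0 e0 i k t -> tie p0 e0 j k t = tie p0 e0 i j t.
Proof.
move=> ij ik jk E.
have := shifted_costB yh p0 e0 (t, tie p0 e0 i j t) ij.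
have := shifted_costB yh p0 e0 (t, tie p0 e0 i j t) ik.
have := shifted_costB yh p0 e0 (t, tie p0 e0 i j t) jk.
rewrite /= -E subrr !mulr0 => H /eqP; rewrite subr_eq0 => /eqP H1 /eqP.
rewrite subr_eq0 => /eqP H2; move: H; rewrite -H1 -H2 subrr => /esym/eqP.
rewrite !mulf_eq0 pnatr_eq0 /= !subr_eq0 eq_sym (negbTE (yh jk)) /=.
by move=> /eqP.
Qed.

Lemma tie_neq_between i j k : (y j).2 < (y i).2 -> (y i).2 < (y k).2 ->
  exists2 t, T t & tie p0 e0 i j t < tie p0 e0 i k t.
Proof.
move=> ji ik; have [t [s [r [r0 Os _ _ H]]]] := cell_vertical i.
exists t; first by exists s.
have := (H j).2 ji; have := (H k).1 ik; lra.
Qed.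

(** The cell of the point of middle height is squeezed between its ties with the other two, which
    therefore differ on a line through a box in that cell. By [tie_triple] the same line serves the
    two other indices. *)
Lemma tie_neq i j k : i != j -> i != k -> j != k ->
  exists2 t, T t & tie p0 e0 i j t != tie p0 e0 i k t.
Proof.
move=> ij ik jk.
have ji : j != i by rewrite eq_sym. have ki : k != i by rewrite eq_sym.
have kj : k != j by rewrite eq_sym.
have C2 a b : a != b -> tie p0 e0 a b =1 tie p0 e0 b a by move=> ab t; exact: tieC.
have useneq a b c : (y b).2 < (y a).2 -> (y a).2 < (y c).2 ->
   exists2 t, T t & tie p0 e0 a b t != tie p0 e0 a c t.
  by move=> h1 h2; have [t Tt lt] := tie_neq_between h1 h2; exists t => //; rewrite lt_eqF.
have fromj t : tie p0 e0 j i t != tie p0 e0 j k t -> tie p0 e0 i j t != tie p0 e0 i k t.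
  by apply: contra_neq => E; rewrite (tie_triple ij ik jk E) C2.
have fromk t : tie p0 e0 k i t != tie p0 e0 k j t -> tie p0 e0 i j t != tie p0 e0 i k t.
  by apply: contra_neq => E; rewrite (C2 k j) // (tie_triple ij ik jk E) (C2 k i).
have sy a b c t : tie p0 e0 a b t != tie p0 e0 a c t -> tie p0 e0 a c t != tie p0 e0 a b t.
  by rewrite eq_sym.
have [bij|bij|/eqP] := ltgtP (y i).2 (y j).2; last by rewrite (negbTE (yh ij)).
  have [bik|bik|/eqP] := ltgtP (y i).2 (y k).2; last by rewrite (negbTE (yh ik)).
    have [bjk|bjk|/eqP] := ltgtP (y j).2 (y k).2; last by rewrite (negbTE (yh jk)).
      by have [t Tt /fromj] := useneq _ _ _ bij bjk; exists t.
    by have [t Tt /fromk] := useneq _ _ _ bik bjk; exists t.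
  by have [t Tt /sy] := useneq _ _ _ bik bij; exists t.
have [bik|bik|/eqP] := ltgtP (y i).2 (y k).2; last by rewrite (negbTE (yh ik)).
  by have [t Tt] := useneq _ _ _ bij bik; exists t.
have [bjk|bjk|/eqP] := ltgtP (y j).2 (y k).2; last by rewrite (negbTE (yh jk)).
  by have [t Tt /sy /fromk] := useneq _ _ _ bjk bik; exists t.
by have [t Tt /sy /fromj] := useneq _ _ _ bjk bij; exists t.
Qed.

(** The abscissae at which two quantities compared by [cell_top], by [cell_bottom] or in top minus
    bottom against 0 may have equal values at [(p0, e0)]. *)
Let degenerate t := T t /\ (lo t = up t \/ exists i, exists j, i != j /\
  (tie p0 e0 i j t = up t \/ tie p0 e0 i j t = lo t \/
   exists k, (i != k /\ j != k) /\ tie p0 e0 i j t = tie p0 e0 i k t)).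

Let thin_concave (f : R -> R) c : T c -> 0 < f c ->
  (forall t u l, T t -> T u -> 0 <= l <= 1 ->
    (1 - l) * f t + l * f u <= f ((1 - l) * t + l * u)) ->
  thin (fun t => T t /\ f t = 0).
Proof.
move=> Tc fc cf; have [x1 [x2 H]] := concave_zeros cf Tc fc.
by apply: (thin_pair (x1 := x1) (x2 := x2)) => t [Tt ft]; exact: H.
Qed.

(** Each coincidence is a zero of a function concave on [T]: [up - lo], [up - tie], [tie - lo], or a
    difference of ties, which is affine. Positive cell areas make it positive somewhere: a tie of
    [i] and [j] lies below [up] on a line through the cell of the higher point and above [lo] on a
    line through the cell of the lower one. *)
Lemma thin_degenerate : thin degenerate.
Proof.
pose Z (f : R -> R) t := T t /\ f t = 0.
apply: (@thinW _ _ (fun t => Z (up \- lo) t \/ exists i, exists j, i != j /\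
  (Z (fun t => up t - tie p0 e0 i j t) t \/ (Z (fun t => tie p0 e0 i j t - lo t) t \/
   exists k, (i != k /\ j != k) /\ Z (fun t => tie p0 e0 i j t - tie p0 e0 i k t) t)))).
  move=> t [Tt [E|[i [j [ij H]]]]]; first by left; split => //=; rewrite E subrr.
  right; exists i, j; split => //.
  case: H => [E|[E|[k [ijk E]]]]; [left|right; left|right; right; exists k; split => //].
  - by split => //; rewrite E subrr.
  - by split => //; rewrite E subrr.
  - by split => //; rewrite E subrr.
apply: thin_or.
  have [t [s [r [r0 Os lt ut _]]]] := cell_vertical ord0.
  apply: (thin_concave (c := t)); [by exists s|by rewrite /=; lra|].
  move=> u v l Tu Tv l01 /=; have := up_concave Tu Tv l01; have := lo_convex Tu Tv l01; lra.
apply: thin_exists => i; apply: thin_exists => j; apply: thin_and => ij.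
apply: thin_or.
  have [t Tt pos] : exists2 t, T t & 0 < up t - tie p0 e0 i j t.
    have [bij|bij|/eqP] := ltgtP (y i).2 (y j).2; last by rewrite (negbTE (yh ij)).
      have [t [s [r [r0 Os lt ut H]]]] := cell_vertical j.
      exists t; first by exists s.
      by have := (H i).2 bij; rewrite (tieC yh p0 e0 t ij); lra.
    have [t [s [r [r0 Os lt ut H]]]] := cell_vertical i.
    exists t; first by exists s.
    by have := (H j).2 bij; lra.
  apply: (thin_concave Tt pos) => u v l Tu Tv l01.
  rewrite tie_affine; have := up_concave Tu Tv l01; lra.
apply: thin_or.
  have [t Tt pos] : exists2 t, T t & 0 < tie p0 e0 i j t - lo t.
    have [bij|bij|/eqP] := ltgtP (y i).2 (y j).2; last by rewrite (negbTE (yh ij)).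
      have [t [s [r [r0 Os lt ut H]]]] := cell_vertical i.
      exists t; first by exists s.
      by have := (H j).1 bij; lra.
    have [t [s [r [r0 Os lt ut H]]]] := cell_vertical j.
    exists t; first by exists s.
    by have := (H i).1 bij; rewrite (tieC yh p0 e0 t ij); lra.
  apply: (thin_concave Tt pos) => u v l Tu Tv l01.
  rewrite tie_affine; have := lo_convex Tu Tv l01; lra.
apply: thin_exists => k; apply: thin_and => -[ik jk].
have [t Tt] := tie_neq ij ik jk; rewrite neq_lt => /orP[] lt.
  apply: (@thinW _ _ (fun t => T t /\ tie p0 e0 i k t - tie p0 e0 i j t = 0)).
    by move=> u [Tu /eqP E]; split => //; apply/eqP; rewrite -opprB oppr_eq0.
  apply: (thin_concave Tt); first by rewrite subr_gt0.
  by move=> u v l Tu Tv l01; rewrite !tie_affine; lra.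
apply: (thin_concave Tt); first by rewrite subr_gt0.
by move=> u v l Tu Tv l01; rewrite !tie_affine; lra.
Qed.

Lemma section_length_locally_affine t i : ~ degenerate t ->
  locally_affine (fun p e => section_length Om y p e i t) p0 e0.
Proof.
move=> nd; have [Tt|nT] := pselect (T t); last first.
  rewrite (_ : (fun _ _ => _) = fun _ _ => 0); first exact: locally_affine_cst.
  by apply/funext => p; apply/funext => e; rewrite section_length_out.
have [s Os] := Tt.
rewrite (_ : (fun _ _ => _) = fun p e =>
    Num.max 0 (cell_top y up p e i t - cell_bottom y lo p e i t)); last first.
  by apply/funext => p; apply/funext => e; rewrite (section_lengthE yh Om_section _ _ _ Os).
have bneq j : (y i).2 < (y j).2 \/ (y j).2 < (y i).2 -> i != j.
  by apply: contraPneq => ->; rewrite ltxx; case.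
have nup j : i != j -> tie p0 e0 i j t != up t.
  by move=> ij; apply/eqP => E; apply: nd; split => //; right; exists i, j; split => //; left.
have nlo j : i != j -> tie p0 e0 i j t != lo t.
  move=> ij; apply/eqP => E; apply: nd; split => //.
  by right; exists i, j; split => //; right; left.
have ntie j k : i != j -> i != k -> j != k -> tie p0 e0 i j t != tie p0 e0 i k t.
  move=> ij ik jk; apply/eqP => E; apply: nd; split => //; right; exists i, j; split => //.
  by right; right; exists k.
have la j : locally_affine (fun p e => tie p e i j t) p0 e0.
  by eexists; eexists; exists 1; split => // p e _; exact: tie_linear.
have min_or (a b : R) : Num.min a b = a \/ Num.min a b = b.
  by rewrite /Num.min; case: ifP => _; [left|right].
have max_or (a b : R) : Num.max a b = a \/ Num.max a b = b.
  by rewrite /Num.max; case: ifP => _; [right|left].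
have [la1 V1] := @locally_affine_big R n.+1 Num.min 'I_n.+1 (fun j => (y i).2 < (y j).2) (up t)
  (fun j p e => tie p e i j t) p0 e0
  min_or
  (fun f g => @locally_affine_min _ _ f g p0 e0) (fun j _ => la j)
  (fun j ij => nup j (bneq j (or_introl ij)))
  (fun j k ij ik jk => ntie j k (bneq j (or_introl ij)) (bneq k (or_introl ik)) jk).
have [la2 V2] := @locally_affine_big R n.+1 Num.max 'I_n.+1 (fun j => (y j).2 < (y i).2) (lo t)
  (fun j p e => tie p e i j t) p0 e0
  max_or
  (fun f g => @locally_affine_max _ _ f g p0 e0) (fun j _ => la j)
  (fun j ij => nlo j (bneq j (or_intror ij)))
  (fun j k ij ik jk => ntie j k (bneq j (or_intror ij)) (bneq k (or_intror ik)) jk).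
(* The last comparison is that of top minus bottom with 0. The top is [up t] or a tie with a higher
   point, the bottom [lo t] or a tie with a lower one, so they differ off the degenerate lines. *)
apply: locally_affine_max; [|exact: locally_affine_cst|exact: locally_affineB].
rewrite eq_sym subr_eq0 /cell_top /cell_bottom.
case: V1 => [->|[j ij ->]]; case: V2 => [->|[k ki ->]].
- by apply/eqP => E; apply: nd; split => //; left.
- by rewrite eq_sym nup //; apply: bneq; right.
- by rewrite nlo //; apply: bneq; left.
- apply: ntie; [by apply: bneq; left|by apply: bneq; right|].
  by apply: contraTneq ij => ->; rewrite -leNgt ltW.
Qed.

Lemma frechet_area i : exists a b, frechet (fun p e => area (C p e i)) p0 e0 a b.
Proof.
have [N [fN HN]] := thin_degenerate.
have cN := finite_set_countable fN.
have mN : measurable (N : set (measurableTypeR R)).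
  by apply: countable_measurable => // t; exact: measurable_set1.
have N0 : @lebesgue_measure R N = 0%E by exact: countable_lebesgue_measure0.
have mD : measurable ([set` `[- B, B]] `\` N : set (measurableTypeR R)).
  by apply: measurableD => //; exact: measurable_itv.
have [K [K0 HK]] := section_length_lipschitz.
have [||||a [b H]] := @frechet_integral _ _ R (@lebesgue_measure R) _ mD _ n.+1
  (fun t p e => section_length Om y p e i t) p0 e0 K.
- apply: (@le_lt_trans _ _ (@lebesgue_measure R [set` `[- B, B]])).
    by apply: le_measure; rewrite ?inE.
  by rewrite lebesgue_measure_itv /= lte_fin; case: ifP => _ //; rewrite -EFinD ltry.
- by move=> p e; exact: (integrable_section_length_on y Om_measurable Om_fin Om_bounded p e i mD).
- by move=> t r p e [/=]; rewrite in_itv /= -ler_norml => tB _ cl; exact: HK.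
- by move=> t [_ Nt]; apply: section_length_locally_affine => /HN.
- exists a, b => eta /H[rho [rho0 Hr]]; exists rho; split => // r p e r0 cl.
  by rewrite !(area_section_length y Om_measurable Om_bounded _ _ _ mN N0); exact: Hr.
Qed.

End Generic.
End AreaDifferentiability.

(** * Quantitative injectivity of the cell areas *)

Lemma finite_lower_bound (R : realType) (J : finType) (f : J -> R) :
  (forall j, 0 < f j) -> exists2 m, 0 < m & forall j, m <= f j.
Proof.
move=> f0; exists (\big[Num.min/1]_j f j) => [|j]; first by apply: lt_bigmin.
exact: bigmin_le.
Qed.

(** Take [c] with [f c = g / 2]. Within [g / (4 * M)] of [c] the value moves by at most [g / 4], and
    neither endpoint is closer than that, since [f] differs there from [g / 2] by at least [g / 2].
    The order of [a] and [b] is left open, hence the disjunctions. *)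
Lemma lipschitz_level_interval (R : realType) (f : R -> R) (a b M g : R) :
  continuous f -> 0 < M -> 0 < g -> f a <= 0 -> g <= f b ->
  (forall s s', (a <= s <= b) || (b <= s <= a) -> (a <= s' <= b) || (b <= s' <= a) ->
    `|f s - f s'| <= M * `|s - s'|) ->
  exists c, forall s, c - g / (4 * M) <= s <= c + g / (4 * M) ->
    ((a <= s <= b) || (b <= s <= a)) /\ 0 < f s < g.
Proof.
move=> cf M0 g0 fa fb lip.
have [||l] := @IVT R (fun l => f ((1 - l) * a + l * b)) 0 1 (g / 2) ler01.
- apply: continuous_subspaceT => l.
  apply: (@continuous_comp _ _ _ (fun l : R => (1 - l) * a + l * b)); last exact: cf.
  apply: cvgD; apply: cvgM; try exact: cvg_cst; last exact: cvg_id.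
  by apply: cvgB; [exact: cvg_cst|exact: cvg_id].
- rewrite subr0 mul1r mul0r addr0 subrr mul0r add0r mul1r ge_min le_max.
  by apply/andP; split; apply/orP; [left|right]; lra.
rewrite in_itv /= => /andP[l0 l1].
set c := (1 - l) * a + l * b => fc; exists c.
pose k := g / (4 * M).
have Mk : M * k = g / 4 by rewrite /k; field; rewrite gt_eqF.
have cab : (a <= c <= b) || (b <= c <= a).
  have -> : c = a + l * (b - a) by rewrite /c; ring.
  have l1' : 0 <= 1 - l by rewrite subr_ge0.
  apply/orP; have [ab|ab] := leP a b; [left|right].
    have ab' : 0 <= b - a by rewrite subr_ge0.
    have := mulr_ge0 l0 ab'; have := mulr_ge0 l1' ab'.
    by move=> *; apply/andP; split; lra.
  have ab' : 0 <= a - b by rewrite subr_ge0 ltW.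
  have := mulr_ge0 l0 ab'; have := mulr_ge0 l1' ab'.
  by move=> *; apply/andP; split; lra.
have far v : (a <= v <= b) || (b <= v <= a) -> g / 2 <= `|f c - f v| -> k <= `|c - v|.
  move=> vab fv; rewrite -(ler_pM2l M0) Mk.
  by have := lip _ _ cab vab; lra.
have ka : k <= `|c - a|.
  apply: far; first by rewrite !lexx andbT /= le_total.
  by rewrite fc (le_trans _ (ler_norm _)) //; lra.
have kb : k <= `|c - b|.
  apply: far; first by rewrite !lexx andbT /= le_total.
  by rewrite fc distrC (le_trans _ (ler_norm _)) //; lra.
move=> s /andP[sl sr].
have sab : (a <= s <= b) || (b <= s <= a).
  apply/orP; case/orP: cab => /andP[h1 h2]; [left|right].
    move: ka kb; rewrite ger0_norm ?subr_ge0 // distrC ger0_norm ?subr_ge0 //.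
    by move: sl sr; rewrite -/k; move=> *; apply/andP; split; lra.
  move: ka kb; rewrite distrC ger0_norm ?subr_ge0 // ger0_norm ?subr_ge0 //.
  by move: sl sr; rewrite -/k; move=> *; apply/andP; split; lra.
split => //.
have sk : M * `|s - c| <= g / 4.
  rewrite -Mk ler_pM2l // ler_norml.
  by move: sl sr; rewrite -/k; move=> *; apply/andP; split; lra.
have := lip _ _ sab cab; rewrite fc ler_norml => /andP[e1 e2].
by apply/andP; split; lra.
Qed.

Section Gain.
Context (R : realType) (Om : set (R * R)) (n : nat) (y : 'I_n.+1 -> R * R).
Context (yh : forall i j, i != j -> (y i).2 != (y j).2).
Context (Om_measurable : measurable (Om : set (measurableTypeR R * measurableTypeR R))).
Context (Om_fin : (leb2 Om < +oo)%E) (Om_convex : convex2 Om).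
Context (B : R) (B0 : 0 < B).
Context (Om_bounded : forall x, Om x -> `|x.1| <= B /\ `|x.2| <= B).
Implicit Types (p q : 'rV[R]_n.+1) (e t : R) (i j : 'I_n.+1) (x : R * R).
Local Notation C := (cell Om y).
Local Notation h := (shifted_cost y).
Local Notation tie := (tie y).

(** [i0] only starts the fold; when [S i0] holds, this is the minimum over [S]. *)
Definition group_min (S : pred 'I_n.+1) i0 p e x : R :=
  \big[Num.min/h p e i0 x]_(i | S i) h p e i x.

Lemma group_min_le (S : pred 'I_n.+1) i0 p e x i : S i -> group_min S i0 p e x <= h p e i x.
Proof. exact: bigmin_le_cond. Qed.

Lemma group_min_attained (S : pred 'I_n.+1) i0 p e x : S i0 ->
  exists2 i, S i & group_min S i0 p e x = h p e i x.
Proof.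
move=> S0; rewrite /group_min; elim/big_ind : _; [by exists i0| |by move=> i; exists i].
move=> a b [i Si ->] [j Sj ->]; rewrite /Num.min.
by case: ifP => _; [exists i|exists j].
Qed.

Lemma continuous_group_min (S : pred 'I_n.+1) i0 p e (t s : R -> R) :
  continuous t -> continuous s -> continuous (fun l => group_min S i0 p e (t l, s l)).
Proof.
move=> ct cs.
have ch i : continuous (fun l => h p e i (t l, s l)).
  move=> l; rewrite /h /cost /=.
  apply: cvgB; last exact: cvg_cst.
  have c1 : t l - (y i).1 @[l --> l] --> t l - (y i).1 by apply: cvgB; [exact: ct|exact: cvg_cst].
  have c2 : s l - (y i).2 @[l --> l] --> s l - (y i).2 by apply: cvgB; [exact: cs|exact: cvg_cst].
  apply: cvgD; last by rewrite expr2; under eq_fun do rewrite expr2; exact: cvgM.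
  apply: cvgM; first exact: cvg_cst.
  by rewrite expr2; under eq_fun do rewrite expr2; exact: cvgM.
rewrite /group_min; elim: (index_enum _) => [|i r IH].
  by under eq_fun do rewrite big_nil; exact: ch.
have [Si|nSi] := boolP (S i); last by under eq_fun do rewrite big_cons (negbTE nSi).
by under eq_fun do rewrite big_cons Si; move=> l; exact: (continuous_min (ch i l) (IH l)).
Qed.

Lemma group_min_lipschitz p e : exists L, 0 < L /\ forall (S : pred 'I_n.+1) i0 x x',
  `|x.1| <= B -> `|x.2| <= B -> `|x'.1| <= B -> `|x'.2| <= B ->
  `|group_min S i0 p e x - group_min S i0 p e x'| <= L * (`|x.1 - x'.1| + `|x.2 - x'.2|).
Proof.
pose L i := (`|e| + 1) * (2 * B + 2 * (`|(y i).1| + `|(y i).2|)).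
have L0 i : 0 <= L i.
  by rewrite mulr_ge0 ?addr_ge0 ?mulr_ge0 ?addr_ge0 // ltW.
exists (1 + \sum_i L i); split; first by rewrite ltr_pwDl ?sumr_ge0.
move=> S i0 x x' x1 x2 x1' x2'.
have Hi i : `|h p e i x - h p e i x'| <= (1 + \sum_i L i) * (`|x.1 - x'.1| + `|x.2 - x'.2|).
  apply: (@le_trans _ _ (L i * (`|x.1 - x'.1| + `|x.2 - x'.2|))); last first.
    by rewrite ler_wpM2r ?addr_ge0 // (bigD1 i) //= addrCA lerDl addr_ge0 ?sumr_ge0.
  rewrite (_ : h p e i x - h p e i x' =
    e * (x.1 + x'.1 - 2 * (y i).1) * (x.1 - x'.1) +
    (x.2 + x'.2 - 2 * (y i).2) * (x.2 - x'.2)); last by rewrite /h /cost; ring.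
  have b1 : `|x.1 + x'.1 - 2 * (y i).1| <= 2 * B + 2 * (`|(y i).1| + `|(y i).2|).
    apply: (le_trans (ler_normB _ _)); apply: lerD.
      by apply: (le_trans (ler_normD _ _)); rewrite mulr_natl mulr2n lerD.
    by rewrite normrM ger0_norm // ler_wpM2l // lerDl.
  have b2 : `|x.2 + x'.2 - 2 * (y i).2| <= 2 * B + 2 * (`|(y i).1| + `|(y i).2|).
    apply: (le_trans (ler_normB _ _)); apply: lerD.
      by apply: (le_trans (ler_normD _ _)); rewrite mulr_natl mulr2n lerD.
    by rewrite normrM ger0_norm // ler_wpM2l // lerDr.
  apply: (le_trans (ler_normD _ _)); rewrite [leRHS]mulrDr.
  apply: lerD; rewrite normrM ler_wpM2r //.
    by rewrite normrM ler_pM // lerDl.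
  by apply: (le_trans b2); rewrite ler_peMl ?lerDr // (le_trans _ b2).
rewrite /group_min; elim/big_ind2 : _ => // a b c d.
by rewrite !ler_norml => /andP[? ?] /andP[? ?]; rewrite /Num.min; do 2 case: ifP => /= ?; lra.
Qed.

Context (p0 : 'rV[R]_n.+1) (e0 : R) (area_gt0 : forall i, 0 < area (C p0 e0 i)).

Section Groups.
Context (S : pred 'I_n.+1) (i1 i2 : 'I_n.+1) (Si1 : S i1) (Si2 : ~~ S i2).

(** Inside [Om] the cells of [S] at [p0] make up the region [D <= 0]. When the coordinates in [S]
    gain [g] on the others, their cells contain the region [D < g], so the gain is at least the area
    of the layer [0 < D < g]. *)
Let D x := group_min S i1 p0 e0 x - group_min (predC S) i2 p0 e0 x.

Let D_tie x : D x = 0 -> exists i j, i != j /\ x.2 = tie p0 e0 i j x.1.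
Proof.
move=> /eqP; rewrite subr_eq0 => /eqP.
have [i Si ->] := group_min_attained p0 e0 x Si1.
have [j /= Sj ->] := @group_min_attained (predC S) i2 p0 e0 x Si2.
move=> E; exists i, j; have ij : i != j by apply: contraNneq Sj => <-.
split => //; have := shifted_costB yh p0 e0 x ij.
rewrite E subrr => /esym/eqP; rewrite !mulf_eq0 pnatr_eq0 /= !subr_eq0 eq_sym (negbTE (yh ij)) /=.
by move=> /eqP.
Qed.

Let D_cell_in i x : S i -> C p0 e0 i x -> D x <= 0.
Proof.
move=> Si /cellP[_ H]; rewrite subr_le0 (le_trans (group_min_le _ _ _ _ Si)) //.
by have [j /= Sj ->] := @group_min_attained (predC S) i2 p0 e0 x Si2.
Qed.

Let D_cell_out j x : ~~ S j -> C p0 e0 j x -> 0 <= D x.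
Proof.
move=> Sj /cellP[_ H]; rewrite subr_ge0 (le_trans (@group_min_le (predC S) _ _ _ _ j Sj)) //.
by have [i Si ->] := group_min_attained p0 e0 x Si1.
Qed.

Let continuous_D (t s : R -> R) : continuous t -> continuous s ->
  continuous (fun l => D (t l, s l)).
Proof. by move=> ct cs l; apply: cvgB; exact: continuous_group_min. Qed.

(* Between a box in a cell of [S] and a box in a cell outside [S], the sum of
   [D] over finitely many points of a moving vertical segment changes sign. Where
   it vanishes, either [D] takes both signs on that segment or it vanishes at all
   the points; the latter is impossible as there are more points than ties. *)
Let sign_change : exists t a b r, [/\ 0 < r, D (t, a) < 0, 0 < D (t, b) &
  forall u s, `|u - t| <= r -> (s = a \/ s = b) -> Om (u, s)].
Proof.
have [z1 [r1 [r10 H1]]] := cell_box Om_measurable Om_convex area_gt0 i1.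
have [z2 [r2 [r20 H2]]] := cell_box Om_measurable Om_convex area_gt0 i2.
pose r := Num.min r1 r2; have r0 : 0 < r by rewrite lt_min r10.
pose T l : R := (1 - l) * z1.1 + l * z2.1.
pose s (k : 'I_(n.+1 * n.+1).+1) l : R := (1 - l) * z1.2 + l * z2.2 + r * (k%:R / (n.+1 * n.+1)%:R).
have k01 (k : 'I_(n.+1 * n.+1).+1) : 0 <= (k%:R / (n.+1 * n.+1)%:R : R) <= 1.
  by rewrite divr_ge0 //= ler_pdivrMr ?ltr0n ?muln_gt0 // mul1r ler_nat -ltnS ltn_ord.
have krn (k : 'I_(n.+1 * n.+1).+1) : `|r * (k%:R / (n.+1 * n.+1)%:R)| <= r.
  have /andP[k0 k1] := k01 k.
  by rewrite ger0_norm ?mulr_ge0 ?(ltW r0) // ger_pMr.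
have cT : continuous T.
  move=> l; apply: cvgD; apply: cvgM; try exact: cvg_cst; last exact: cvg_id.
  by apply: cvgB; [exact: cvg_cst|exact: cvg_id].
have cs k : continuous (s k).
  move=> l; apply: cvgD; last exact: cvg_cst.
  apply: cvgD; apply: cvgM; try exact: cvg_cst; last exact: cvg_id.
  by apply: cvgB; [exact: cvg_cst|exact: cvg_id].
pose I l := \sum_k D (T l, s k l).
have cI : continuous I.
  by apply: continuous_big => [|k _]; [exact: add_continuous|exact: continuous_D].
have I0 : I 0 <= 0.
  apply: sumr_le0 => k _; apply: (D_cell_in Si1); apply: H1; rewrite /= /T /s.
    by rewrite subr0 mul1r mul0r addr0 subrr normr0 ltW.
  rewrite subr0 mul1r mul0r addr0 addrAC subrr add0r (le_trans (krn k)) //.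
  by rewrite ge_min lexx.
have I1 : 0 <= I 1.
  apply: sumr_ge0 => k _; apply: (D_cell_out Si2); apply: H2; rewrite /= /T /s.
    by rewrite subrr mul1r mul0r add0r subrr normr0 ltW.
  rewrite subrr mul1r mul0r add0r addrAC subrr add0r (le_trans (krn k)) //.
  by rewrite ge_min lexx orbT.
have [|l] := @IVT R I 0 1 0 ler01 (continuous_subspaceT cI) _.
  by rewrite ge_min I0 le_max I1 orbT.
rewrite in_itv /= => l01 Il.
have nz : exists k, D (T l, s k l) != 0.
  apply: contrapT => /forallNP nz.
  have /choice[f Hf] : forall k, exists ij : 'I_n.+1 * 'I_n.+1, s k l = tie p0 e0 ij.1 ij.2 (T l).
    move=> k; have /negP := nz k; rewrite negbK => /eqP /D_tie[i [j [_ E]]].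
    by exists (i, j).
  have fi : injective f.
    move=> k k' E; have := Hf k; rewrite E -Hf /s => /addrI /(mulfI (lt0r_neq0 r0)).
    move=> /(mulIf _) H; apply/val_inj/eqP; rewrite -(eqr_nat R); apply/eqP/H.
    by rewrite invr_eq0 pnatr_eq0 muln_eq0.
  have := leq_card f fi.
  by rewrite card_prod !card_ord ltnn.
have [a Da] : exists k, D (T l, s k l) < 0.
  apply: contrapT => /forallNP nneg; case: nz => k /negP; apply.
  have nn k' : 0 <= D (T l, s k' l) by rewrite leNgt; apply/negP/nneg.
  have /eqP := Il; rewrite psumr_eq0 // => /allP /(_ k).
  by rewrite mem_index_enum => /(_ isT).
have [b Db] : exists k, 0 < D (T l, s k l).
  apply: contrapT => /forallNP npos; case: nz => k /negP; apply.
  have nn k' : 0 <= - D (T l, s k' l) by rewrite oppr_ge0 leNgt; apply/negP/npos.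
  have /eqP : \sum_k - D (T l, s k l) = 0 by rewrite sumrN -/(I l) Il oppr0.
  rewrite psumr_eq0 // => /allP /(_ k).
  by rewrite mem_index_enum oppr_eq0 => /(_ isT).
exists (T l), (s a l), (s b l), r; split => // u v ul sv.
(* Translating by [u - T l] keeps the points in the two boxes; convexity supplies the point between
   them. *)
have key k : Om (u, s k l).
  pose w1 := (z1.1 + (u - T l), z1.2 + r * (k%:R / (n.+1 * n.+1)%:R)).
  pose w2 := (z2.1 + (u - T l), z2.2 + r * (k%:R / (n.+1 * n.+1)%:R)).
  have O1 : Om w1.
    have [] // := H1 w1; rewrite /w1 /= addrAC subrr add0r.
      by rewrite (le_trans ul) // ge_min lexx.
    by rewrite (le_trans (krn k)) // ge_min lexx.
  have O2 : Om w2.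
    have [] // := H2 w2; rewrite /w2 /= addrAC subrr add0r.
      by rewrite (le_trans ul) // ge_min lexx orbT.
    by rewrite (le_trans (krn k)) // ge_min lexx orbT.
  rewrite (_ : (u, s k l) = ((1 - l) * w1.1 + l * w2.1, (1 - l) * w1.2 + l * w2.2)).
    exact: Om_convex.
  by congr pair; rewrite /w1 /w2 /s /T /=; ring.
by case: sv => ->.
Qed.

Let U q : set (measurableTypeR R * measurableTypeR R) := \bigcup_(i in [set i | S i]) C q e0 i.

Let measurable_U q : measurable (U q).
Proof.
by apply: fin_bigcup_measurable => [|i _]; [exact: finite_finset|exact: measurable_cell].
Qed.

Let leb2_U q : leb2 (U q) = (\sum_(i | S i) area (C q e0 i))%:E.
Proof.
have -> : U q = \big[setU/set0]_(i <- enum S) C q e0 i.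
  by rewrite -bigcup_seq /U; congr bigcup; apply/seteqP; split => i /=; rewrite mem_enum.
rewrite (leb2_cell_union yh Om_measurable Om_fin) ?enum_uniq // -sumEFin big_enum /=.
apply: eq_bigr => i _; rewrite /area fineK //.
by rewrite ge0_fin_numE ?(leb2_cell_fin y Om_measurable Om_fin).
Qed.

(** On every vertical line within [rho] of [t], [D] passes from at most [- d] to at least [d], so
    the layer [0 < D < g] contains a segment of length [g / (4 * L)]. Over lines filling a width
    [2 * rho] this amounts to [rho / (2 * L) * g]. *)
Lemma area_gain : exists c d, [/\ 0 < c, 0 < d & forall q g, 0 < g <= d ->
  (forall i j, S i -> ~~ S j -> q ord0 j - p0 ord0 j + g <= q ord0 i - p0 ord0 i) ->
  \sum_(i | S i) area (C p0 e0 i) + c * g <= \sum_(i | S i) area (C q e0 i)].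
Proof.
have [t [a [b [r [r0 Da Db Oab]]]]] := sign_change.
have [L [L0 HL]] := group_min_lipschitz p0 e0.
have DL x x' : Om x -> Om x' -> `|D x - D x'| <= 2 * L * (`|x.1 - x'.1| + `|x.2 - x'.2|).
  move=> /Om_bounded[b1 b2] /Om_bounded[b1' b2'].
  have := HL S i1 _ _ b1 b2 b1' b2'; have := HL (predC S) i2 _ _ b1 b2 b1' b2'.
  by rewrite /D !ler_norml => /andP[? ?] /andP[? ?]; apply/andP; split; lra.
(* One half of the margin is spent on moving from [t] to a nearby line, [D] being [2 * L]-Lipschitz;
   the other half leaves room for every level [g <= d]. *)
pose d := Num.min (- D (t, a)) (D (t, b)) / 2.
have d0 : 0 < d by rewrite divr_gt0 // lt_min oppr_gt0 Da.
have da : D (t, a) <= - (2 * d).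
  by rewrite lerNr /d mulrC divfK // ge_min lexx.
have db : 2 * d <= D (t, b) by rewrite /d mulrC divfK // ge_min lexx orbT.
pose rho := Num.min r (d / (2 * L)).
have rho0 : 0 < rho by rewrite lt_min r0 divr_gt0 // mulr_gt0.
have Lrho : 2 * L * rho <= d.
  by rewrite mulrC -ler_pdivlMr ?mulr_gt0 // ge_min lexx orbT.
exists (rho / (2 * L)), d; split => //; first by rewrite divr_gt0 // mulr_gt0.
move=> q g /andP[g0 gd] qg.
(* If [x] were in the cell at [q] of some [j] outside [S], the lead of [S] over [j] would give
   [g <= D x]. *)
have Uq x : Om x -> D x < g -> U q x.
  move=> Ox Dg; have [j Cj] := cell_covers y q e0 Ox; exists j => //=.
  apply: contraT => Sj; move: Dg; rewrite ltNge => /negP; case.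
  have [i Si iE] := group_min_attained p0 e0 x Si1.
  rewrite /D iE; have := @group_min_le (predC S) i2 p0 e0 x j Sj.
  have /cellP[_ /(_ i)] := Cj; have := qg i j Si Sj; rewrite /h; lra.
have Up x : D x > 0 -> ~ U p0 x.
  by move=> D0 [i /= Si /(D_cell_in Si)]; rewrite leNgt D0.
have Upq : U p0 `<=` U q.
  move=> x [i /= Si Ci]; apply: Uq; first by case: Ci.
  exact: le_lt_trans (D_cell_in Si Ci) g0.
have mW : measurable (U q `\` U p0) by exact: measurableD.
have UE : leb2 (U q) = (leb2 (U p0) + leb2 (U q `\` U p0))%E.
  rewrite -[in LHS](setDUK Upq) /leb2 measureU //.
  by apply/seteqP; split => // x [? []].
pose k := g / (8 * L).
have k0 : 0 < k by rewrite divr_gt0 // mulr_gt0.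
have W_section u : `|u - t| <= rho -> exists s1,
    [set` `[s1 - k, s1 + k]] `<=` xsection (U q `\` U p0) u.
  move=> ut.
  have utr : `|u - t| <= r by rewrite (le_trans ut) // ge_min lexx.
  have tt : `|t - t| <= r by rewrite subrr normr0 ltW.
  have Dta := DL _ _ (Oab _ _ utr (or_introl erefl)) (Oab _ _ tt (or_introl (erefl a))).
  have Dtb := DL _ _ (Oab _ _ utr (or_intror erefl)) (Oab _ _ tt (or_intror (erefl b))).
  have Lu : 2 * L * `|u - t| <= d by apply: le_trans Lrho; rewrite ler_pM2l // mulr_gt0.
  rewrite /= subrr normr0 addr0 in Dta; rewrite /= subrr normr0 addr0 in Dtb.
  have Dua : D (u, a) <= - d.
    by move: Dta; rewrite ler_norml => /andP[_]; lra.
  have Dub : d <= D (u, b).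
    by move: Dtb; rewrite ler_norml => /andP[+ _]; lra.
  have Oa := Oab _ _ utr (or_introl (erefl a)).
  have Ob := Oab _ _ utr (or_intror (erefl b)).
  have Ou s : (a <= s <= b) || (b <= s <= a) -> Om (u, s).
    by move=> /orP[]; exact: convex2_vertical.
  have cD : continuous (fun s => D (u, s)).
    by apply: continuous_D => s; [exact: cvg_cst|exact: cvg_id].
  have L20 : 0 < 2 * L by rewrite mulr_gt0.
  have [||s s' /Ou Os /Ou Os'|s1 H1] := lipschitz_level_interval (a := a) (b := b) cD L20 g0.
  - by apply: le_trans Dua _; rewrite oppr_le0 ltW.
  - exact: le_trans Dub.
  - by have := DL _ _ Os Os'; rewrite /= subrr normr0 add0r.
  exists s1 => s /=; rewrite in_itv /= (_ : k = g / (4 * (2 * L))); last first.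
    by rewrite /k; congr (_ / _); ring.
  move=> /H1[/Ou Os /andP[Ds0 Dsg]].
  by apply/xsectionP; split; [exact: Uq|exact: Up].
pose J : set (measurableTypeR R) := [set` `[t - rho, t + rho]].
have mJ : measurable J by exact: measurable_itv.
have W_area : ((rho / (2 * L) * g)%:E <= leb2 (U q `\` U p0))%E.
  rewrite /leb2 /product_measure1.
  apply: (@le_trans _ _ (\int[lebesgue_measure]_(u in J)
     (lebesgue_measure \o xsection (U q `\` U p0)) u)%E); last first.
    by apply: ge0_subset_integral => //; exact: measurable_fun_xsection.
  apply: (@le_trans _ _ (\int[lebesgue_measure]_(u in J)
     (cst (2 * k)%:E) u)%E).
    rewrite integral_cst //= /J lebesgue_measure_itv /= lte_fin ifT; last by lra.
    rewrite -EFinB -EFinM lee_fin /k le_eqVlt; apply/orP; left; apply/eqP; field.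
    by rewrite gt_eqF.
  apply: ge0_le_integral => //.
  - by move=> u _; rewrite lee_fin mulr_ge0 // ltW.
  - by apply: measurable_funTS; exact: measurable_fun_xsection.
  - move=> u; rewrite /J /= in_itv /= => /andP[u1 u2].
    have [|s1 Hs1] := W_section u; first by rewrite ler_norml; apply/andP; split; lra.
    rewrite (_ : (2 * k)%:E = @lebesgue_measure R [set` `[s1 - k, s1 + k]]).
      apply: le_measure; rewrite ?inE //; exact: measurable_xsection.
    rewrite lebesgue_measure_itv /= lte_fin ifT; last by lra.
    by rewrite -EFinB; congr EFin; ring.
by rewrite -lee_fin EFinD -!leb2_U UE leeD2l.
Qed.

End Groups.

(** Pigeonhole for [v = q - p0]: cut the interval from 0 to [|v k|] into [n.+1] open slots. The
    value 0 at [ord0] lies in none of them, so the other [n] indices leave one empty, and [S]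
    collects the indices above it. If [v k < 0] the slots are those of [- v] and [S] is the
    complement. [S] is a finite function so that constants can be minimised over all groups. *)
Lemma gap_group q k : q ord0 ord0 = p0 ord0 ord0 -> q ord0 k != p0 ord0 k ->
  exists (S : {ffun 'I_n.+1 -> bool}), [/\ exists i, S i, exists j, ~~ S j &
  forall i j, S i -> ~~ S j ->
    q ord0 j - p0 ord0 j + `|q ord0 k - p0 ord0 k| / n.+1%:R <= q ord0 i - p0 ord0 i].
Proof.
move=> q0 qk; pose v i := q ord0 i - p0 ord0 i.
have v0 : v ord0 = 0 by rewrite /v q0 subrr.
have vk : 0 < `|v k| by rewrite normr_gt0 subr_eq0.
pose w i := if 0 <= v k then v i else - v i.
have wk : w k = `|v k|.
  by rewrite /w; case: ifPn => [/ger0_norm->//|]; rewrite -ltNge => /ltr0_norm->.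
have w0 : w ord0 = 0 by rewrite /w v0 oppr0; case: ifP.
pose g := `|v k| / n.+1%:R.
have g0 : 0 < g by rewrite divr_gt0.
have [m Hm] : exists m : 'I_n.+1, forall i, ~ (m%:R * g < w i < m.+1%:R * g).
  apply: contrapT => /forallNP nm.
  have /choice[f Hf] : forall m : 'I_n.+1, exists i, m%:R * g < w i < m.+1%:R * g.
    by move=> m; have /existsNP[i /contrapT] := nm m; exists i.
  have fi : injective f.
    have lt (m m' : 'I_n.+1) : (m < m')%N -> f m != f m'.
      move=> mm; apply/eqP => E; have := Hf m; have := Hf m'; rewrite E => /andP[h1 _] /andP[_ h2].
      have := lt_trans h1 h2; rewrite ltr_pM2r // ltr_nat ltnS leqNgt.
      by rewrite mm.
    move=> m m' E; apply/val_inj; have [/lt|/lt|//] := ltngtP m m'.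
      by rewrite E eqxx.
    by rewrite E eqxx.
  have [f' _ fK] := injF_bij fi.
  have := Hf (f' ord0); rewrite fK w0 => /andP[+ _].
  by rewrite ltNge mulr_ge0 // ltW.
have gap i j : m.+1%:R * g <= w i -> ~~ (m.+1%:R * g <= w j) -> w j + g <= w i.
  move=> wi; rewrite -ltNge => wj; have := Hm j.
  move=> /negP; rewrite negb_and wj orbF -leNgt => wj'.
  by move: wi; rewrite -natr1 mulrDl mul1r; lra.
have kS : m.+1%:R * g <= w k.
  rewrite wk /g mulrA ler_pdivrMr // mulrC ler_wpM2l ?ler_nat //.
have zS : ~~ (m.+1%:R * g <= w ord0) by rewrite w0 -ltNge mulr_gt0.
have [vk0|vk0] := boolP (0 <= v k).
  exists [ffun i => m.+1%:R * g <= w i]; split.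
  - by exists k; rewrite ffunE.
  - by exists ord0; rewrite ffunE.
  - move=> i j; rewrite !ffunE => wi wj; have := gap i j wi wj.
    by rewrite /w vk0.
exists [ffun i => ~~ (m.+1%:R * g <= w i)]; split.
- by exists ord0; rewrite ffunE.
- by exists k; rewrite ffunE negbK.
- move=> i j; rewrite !ffunE negbK => wi wj; have := gap j i wj wi.
  by rewrite /w (negbTE vk0) -/(v i) -/(v j) -/g; lra.
Qed.

(** There are finitely many groups, so one [c] and one [d] serve them all; the division by [n.+1]
    reflects the width of the gap. With the cap [d] the bound holds for every [q], however far from
    [p0], which makes uniqueness global. *)
Lemma area_injectivity : exists c d, [/\ 0 < c, 0 < d & forall q k,
  q ord0 ord0 = p0 ord0 ord0 ->
  c * Num.min `|q ord0 k - p0 ord0 k| d <= \sum_i `|area (C q e0 i) - area (C p0 e0 i)|].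
Proof.
have /choice[cd Hcd] : forall S : {ffun 'I_n.+1 -> bool}, exists cd : R * R,
    [/\ 0 < cd.1, 0 < cd.2 &
    (exists i, S i) -> (exists j, ~~ S j) -> forall q g, 0 < g <= cd.2 ->
  (forall i j, S i -> ~~ S j -> q ord0 j - p0 ord0 j + g <= q ord0 i - p0 ord0 i) ->
  \sum_(i | S i) area (C p0 e0 i) + cd.1 * g <= \sum_(i | S i) area (C q e0 i)].
  (* Empty and full groups get dummy positive constants, which keep the minimum over all groups
     positive. *)
  move=> S; have [[i1 Si1]|n1] := pselect (exists i, S i); last by exists (1, 1); split.
  have [[i2 Si2]|n2] := pselect (exists j, ~~ S j); last by exists (1, 1); split.
  have [c [d [c0 d0 H]]] := area_gain Si1 Si2.
  by exists (c, d); split.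
have cd1 S : 0 < (cd S).1 by have [] := Hcd S.
have cd2 S : 0 < (cd S).2 by have [] := Hcd S.
have [c c0 Hc] := finite_lower_bound cd1.
have [d d0 Hd] := finite_lower_bound cd2.
exists (c / n.+1%:R), d; split => //; first by rewrite divr_gt0.
move=> q k q0.
have [->|qk] := eqVneq (q ord0 k) (p0 ord0 k).
  by rewrite subrr normr0 min_l ?(ltW d0) // mulr0 sumr_ge0.
have [S [Sn ST HS]] := gap_group q0 qk.
have [cS0 dS0 /(_ Sn ST) H] := Hcd S.
pose g := Num.min `|q ord0 k - p0 ord0 k| d / n.+1%:R.
have m0 : 0 < Num.min `|q ord0 k - p0 ord0 k| d by rewrite lt_min normr_gt0 subr_eq0 qk.
have g0 : 0 < g by rewrite divr_gt0.
have gd : g <= (cd S).2.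
  apply: le_trans (Hd S); rewrite ler_pdivrMr //.
  apply: (@le_trans _ _ d); first by rewrite ge_min lexx orbT.
  by rewrite ler_peMr ?ler1n // ltW.
have Hg : \sum_(i | S i) area (C p0 e0 i) + (cd S).1 * g <= \sum_(i | S i) area (C q e0 i).
  apply: H => [|i j Si Sj]; first by rewrite g0.
  apply: le_trans (HS i j Si Sj); rewrite lerD2l ler_pM2r ?invr_gt0 //.
  by rewrite ge_min lexx.
rewrite mulrAC -mulrA -/g.
apply: (@le_trans _ _ ((cd S).1 * g)); first by rewrite ler_pM2r.
apply: (@le_trans _ _ (\sum_(i | S i) (area (C q e0 i) - area (C p0 e0 i)))).
  by rewrite sumrB lerBrDl.
rewrite [leRHS](bigID S) /= -[leLHS]addr0 lerD ?sumr_ge0 //.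
by apply: ler_sum => i _; exact: ler_norm.
Qed.

End Gain.

(** * Derivatives of the dual functional *)

Section DualFunctional.
Context (R : realType) (Om : set (R * R)) (n : nat) (y : 'I_n.+1 -> R * R).
Context (yh : forall i j, i != j -> (y i).2 != (y j).2).
Context (Om_measurable : measurable (Om : set (measurableTypeR R * measurableTypeR R))).
Context (Om_fin : (leb2 Om < +oo)%E).
Context (B : R) (B0 : 0 < B).
Context (Om_bounded : forall x, Om x -> `|x.1| <= B /\ `|x.2| <= B).
Implicit Types (p q : 'rV[R]_n.+1) (e t : R) (i j : 'I_n.+1) (x : R * R).
Local Notation C := (cell Om y).
Local Notation h := (shifted_cost y).
Local Notation mu2 := (@lebesgue_measure R \x @lebesgue_measure R)%E.

Lemma measurable_min_cost p e :
  measurable_fun [set: measurableTypeR R * measurableTypeR R] (min_cost y p e).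
Proof.
rewrite /min_cost; elim: (index_enum _) => [|i r IH].
  by under eq_fun do rewrite big_nil; exact: (measurable_shifted_cost y p e ord0).
under eq_fun do rewrite big_cons.
by apply: measurable_minr => //; exact: (measurable_shifted_cost y p e i).
Qed.

Lemma integrable_min_cost p e : mu2.-integrable Om (EFin \o min_cost y p e).
Proof.
apply: measurable_bounded_integrable => //.
  by apply: measurable_funTS; exact: measurable_min_cost.
pose M i := `|e| * (B + `|(y i).1|) ^+ 2 + (B + `|(y i).2|) ^+ 2 + `|p ord0 i|.
have M0 i : 0 <= M i by rewrite !addr_ge0 ?mulr_ge0 ?exprn_ge0 // addr_ge0 // ltW.
exists (\sum_i M i); split; first exact: num_real.
move=> K KM x /Om_bounded[x1 x2]; apply: le_trans (ltW KM).
have [i ->] := min_cost_attained y p e x.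
apply: (@le_trans _ _ (M i)); last by rewrite (bigD1 i) //= lerDl sumr_ge0.
have sq (a c : R) : `|a| <= B -> `|(a - c) ^+ 2| <= (B + `|c|) ^+ 2.
  move=> aB; rewrite normrX lerXn2r ?nnegrE ?addr_ge0 ?(ltW B0) //.
  by apply: (le_trans (ler_normB _ _)); rewrite lerD2r.
rewrite /shifted_cost /cost; apply: (le_trans (ler_normB _ _)); rewrite lerD2r.
apply: (le_trans (ler_normD _ _)); rewrite lerD ?sq //.
by rewrite normrM ler_wpM2l // sq.
Qed.

Lemma integrable_cell_indic p e i k :
  mu2.-integrable Om (EFin \o (fun x => k * \1_(C p e i) x)).
Proof.
have mC := measurable_cell y Om_measurable p e i.
apply: measurable_bounded_integrable => //.
  apply: measurable_funM; first exact: measurable_cst.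
  by apply: measurable_funTS; exact: measurable_indic.
exists `|k|; split; first exact: num_real.
move=> K kK x _; apply: le_trans (ltW kK).
by rewrite normrM indicE; case: (_ \in _); rewrite ?normr1 ?normr0 ?mulr1 ?mulr0.
Qed.

Lemma Rintegral_cell_indic p e i k :
  \int[mu2]_(x in Om) (k * \1_(C p e i) x) = k * area (C p e i).
Proof.
have mC := measurable_cell y Om_measurable p e i.
rewrite RintegralZl //; last first.
  have := integrable_cell_indic p e i 1.
  by under [X in EFin \o X]eq_fun do rewrite mul1r.
by rewrite /Rintegral integral_indic // /area /leb2 setIidl // => x [].
Qed.

Let step p i (d : R) : 'rV[R]_n.+1 := p + d *: delta_mx ord0 i.

Let step_eq p i d : step p i d ord0 i = p ord0 i + d.
Proof. by rewrite !mxE !eqxx mulr1. Qed.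

Let step_neq p i d j : j != i -> step p i d ord0 j = p ord0 j.
Proof. by move=> /negbTE ji; rewrite !mxE ji andbF mulr0 addr0. Qed.

(** Raising the [i]-th coordinate by [d] lowers the minimal cost by [d] on the old cell of [i], by
    at most [d] on the new one, and not at all elsewhere. These supergradient inequalities yield
    both the derivative and the areas at a maximizer. *)
Lemma Phi_step p e i d : 0 < d ->
  d * (n.+1%:R^-1 - area (C (step p i d) e i)) <= Phi Om y (step p i d) e - Phi Om y p e
    <= d * (n.+1%:R^-1 - area (C p e i)).
Proof.
move=> d0; set q := step p i d.
have qp j : p ord0 j <= q ord0 j <= p ord0 j + d.
  have [->|ji] := eqVneq j i; first by rewrite step_eq lexx lerDl ltW.
  by rewrite step_neq // lexx lerDl ltW.
have lin : \sum_j q ord0 j = \sum_j p ord0 j + d.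
  rewrite (bigD1 i) //= step_eq [in RHS](bigD1 i) //= addrAC.
  by congr (_ + _ + _); apply: eq_bigr => j ji; rewrite step_neq.
have Ip := integrable_min_cost p e; have Iq := integrable_min_cost q e.
have S1 : \int[mu2]_(x in Om) min_cost y q e x <=
    \int[mu2]_(x in Om) min_cost y p e x - d * area (C p e i).
  rewrite -Rintegral_cell_indic -RintegralB //; last exact: integrable_cell_indic.
  apply: le_Rintegral => //.
    exact: (integrableB Om_measurable Ip (integrable_cell_indic p e i d)).
  move=> x Ox; rewrite indicE; case: (boolP (x \in _)) => [/set_mem [_ ->]|_].
    rewrite mulr1 (le_trans (min_cost_le y q e i x)) // /shifted_cost step_eq; lra.
  rewrite mulr0 subr0; have [j ->] := min_cost_attained y p e x.
  rewrite (le_trans (min_cost_le y q e j x)) // lerD2l lerN2.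
  by have /andP[] := qp j.
have S2 : \int[mu2]_(x in Om) min_cost y p e x - d * area (C q e i) <=
    \int[mu2]_(x in Om) min_cost y q e x.
  rewrite -Rintegral_cell_indic -RintegralB //; last exact: integrable_cell_indic.
  apply: le_Rintegral => //.
    exact: (integrableB Om_measurable Ip (integrable_cell_indic q e i d)).
  move=> x Ox; have [j jE] := min_cost_attained y q e x; rewrite jE.
  have [ji|ji] := eqVneq j i.
    rewrite indicE mem_set; last by split; rewrite -?ji.
    rewrite mulr1 ji /shifted_cost step_eq.
    by have := min_cost_le y p e i x; rewrite /shifted_cost; lra.
  rewrite /shifted_cost step_neq //; apply: le_trans (min_cost_le y p e j x).
  by rewrite gerBl mulr_ge0 ?(ltW d0) // indicE.
rewrite /Phi lin; move: S1 S2; rewrite mulrDr; move: (n.+1%:R^-1) => N *; apply/andP; split; lra.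
Qed.

Context (Om_convex : convex2 Om) (lo up : R -> R).
Context (Om_section : forall t s0, Om (t, s0) ->
    forall s, Om (t, s) <-> lo t <= s <= up t).

Lemma step_close p e i d : param_close `|d| (step p i d) p e e.
Proof.
split=> [j|]; last by rewrite subrr normr0.
have [->|ji] := eqVneq j i; first by rewrite step_eq addrAC subrr add0r.
by rewrite step_neq // subrr normr0.
Qed.

Lemma is_derive_Phi p e i :
  is_derive p (delta_mx ord0 i) (Phi Om y ^~ e) (n.+1%:R^-1 - area (C p e i)).
Proof.
have [K [K0 HK]] := area_lipschitz yh Om_measurable Om_fin B0 Om_section Om_bounded.
suff cv : (fun k : R => k^-1 *: ((Phi Om y ^~ e \o shift p) (k *: delta_mx ord0 i) - Phi Om y p e))
    @ 0^' --> n.+1%:R^-1 - area (C p e i).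
  by split; [exact: (cvgP _ cv)|exact: (cvg_lim _ cv)].
apply/cvgrPdist_le => eta eta0.
have K10 : 0 < K + 1 by rewrite ltr_wpDl.
have ek0 : 0 < eta / (K + 1) by rewrite divr_gt0.
near=> k.
have k0 : k != 0 by near: k; exact: nbhs_dnbhs_neq.
have kK : K * `|k| <= eta.
  apply: (@le_trans _ _ ((K + 1) * `|k|)); first by rewrite ler_wpM2r // lerDl.
  rewrite mulrC -ler_pdivlMr //; near: k; apply: nbhs_dnbhs.
  apply/nbhs_ballP; exists (eta / (K + 1)); first exact: ek0.
  by move=> z; rewrite /ball /= sub0r normrN => /ltW.
have stE : k *: delta_mx ord0 i + p = step p i k by rewrite /step addrC.
rewrite /= stE.
have := HK _ _ _ _ _ i (step_close p e i k).
set a := area (C p e i); set b := area (C (step p i k) e i) => ab.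
set N := n.+1%:R^-1; set v := k^-1 *: (_ - _).
have vk : k * v = Phi Om y (step p i k) e - Phi Om y p e.
  by rewrite /v /GRing.scale /= mulVKf.
suff [h1|h1] : N - b <= v <= N - a \/ N - a <= v <= N - b.
- move: (le_trans ab kK) h1; rewrite !ler_norml => /andP[? ?] /andP[? ?].
  by apply/andP; split; lra.
- move: (le_trans ab kK) h1; rewrite !ler_norml => /andP[? ?] /andP[? ?].
  by apply/andP; split; lra.
(* A negative step is a positive one from the shifted point back to [p], which exchanges the two
   bounds. *)
have [kn|kp|] := ltgtP k 0; last by move/eqP; rewrite (negbTE k0).
- right; have nk : 0 < - k by rewrite oppr_gt0.
  have := Phi_step (step p i k) e i nk.
  rewrite (_ : step (step p i k) i (- k) = p); last by rewrite /step scaleNr addrK.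
  rewrite -/a -/b -[X in _ <= X <= _]opprB -vk -mulNr.
  by rewrite !ler_pM2l.
- by left; have := Phi_step p e i kp; rewrite -/a -/b -vk !ler_pM2l.
Unshelve. all: by end_near. Qed.

(** Steps of either sign do not increase the functional, so [Phi_step] compares [1/N] with areas at
    nearby points, and the Lipschitz bound lets the step tend to 0. *)
Lemma maximizer_area p e i : (forall q, Phi Om y q e <= Phi Om y p e) ->
  area (C p e i) = n.+1%:R^-1.
Proof.
move=> pmax; have [K [K0 HK]] := area_lipschitz yh Om_measurable Om_fin B0 Om_section Om_bounded.
set N := n.+1%:R^-1.
have up1 d : 0 < d -> N <= area (C p e i) + K * d.
  move=> d0; have /andP[h1 _] := Phi_step p e i d0.
  have h2 : d * (N - area (C (step p i d) e i)) <= 0.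
    by apply: le_trans h1 _; rewrite subr_le0.
  have := HK _ _ _ _ _ i (step_close p e i d).
  rewrite pmulr_rle0 // in h2; rewrite (gtr0_norm d0) ler_norml => /andP[_]; lra.
have lo1 d : 0 < d -> area (C p e i) <= N + K * d.
  move=> d0; have := Phi_step (step p i (- d)) e i d0.
  rewrite (_ : step (step p i (- d)) i d = p); last by rewrite /step scaleNr subrK.
  move=> /andP[_ h1].
  have h2 : 0 <= d * (N - area (C (step p i (- d)) e i)).
    by apply: le_trans h1; rewrite subr_ge0.
  have := HK _ _ _ _ _ i (step_close p e i (- d)).
  rewrite pmulr_rge0 // in h2; rewrite normrN (gtr0_norm d0) ler_norml => /andP[+ _]; lra.
have small (u v : R) : (forall d, 0 < d -> u <= v + K * d) -> u <= v.
  move=> H; apply/ler_addgt0Pr => eta eta0.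
  have K10 : 0 < K + 1 by rewrite ltr_wpDl.
  apply: le_trans (H (eta / (K + 1)) (divr_gt0 eta0 K10)) _.
  by rewrite lerD2l mulrCA ler_piMr ?(ltW eta0) // ler_pdivrMr // mul1r lerDl.
by apply/le_anti; rewrite !small.
Qed.

Lemma sum_area p e : \sum_i area (C p e i) = fine (leb2 Om).
Proof.
have OmE : Om = \big[setU/set0]_(i <- index_enum 'I_n.+1) C p e i.
  rewrite -bigcup_seq; apply/seteqP; split => x; last by move=> [i _ []].
  by move=> /(cell_covers y p e)[i Ci]; exists i => //=; rewrite mem_index_enum.
rewrite [in RHS]OmE (leb2_cell_union yh Om_measurable Om_fin) ?index_enum_uniq //.
rewrite -[LHS]/(fine (\sum_i area (C p e i))%:E) -sumEFin; congr fine.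
apply: eq_bigr => i _; rewrite /area fineK //.
by rewrite ge0_fin_numE ?(leb2_cell_fin y Om_measurable Om_fin).
Qed.

End DualFunctional.

(** * Partial derivatives from Frechet expansions, and symmetry of second derivatives *)

Section SecondDerivative.
Context (R : realType) (m : nat).
Implicit Types (f : 'rV[R]_m -> R) (p q u v : 'rV[R]_m).

Lemma is_derive_line f u v (c l : R) : is_derive (u + c *: v) v f l ->
  is_derive c 1 (fun t : R => f (u + t *: v)) l.
Proof.
move=> [df <-]; suff E :
  (fun h : R => h^-1 *: (((fun t : R => f (u + t *: v)) \o shift c) (h *: 1) - f (u + c *: v)))
   = (fun h : R => h^-1 *: ((f \o shift (u + c *: v)) (h *: v) - f (u + c *: v))).
  by split; rewrite /derivable ?/derive E.
apply/funext => h /=; congr (_ *: (f _ - _)).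
by rewrite -[h *: 1]/(h * 1) mulr1 scalerDl addrCA.
Qed.

Lemma frechet_derive (f : 'rV[R]_m -> R -> R) p e a b j : frechet f p e a b ->
  is_derive p (delta_mx ord0 j) (f ^~ e) (a j).
Proof.
move=> fr.
suff cv : (fun k : R => k^-1 *: ((f ^~ e \o shift p) (k *: delta_mx ord0 j) - f p e)) @ 0^' --> a j.
  by split; [exact: (cvgP _ cv)|exact: (cvg_lim _ cv)].
apply/cvgrPdist_le => eta eta0; have [rho [rho0 H]] := fr eta eta0.
near=> k.
have k0 : k != 0 by near: k; exact: nbhs_dnbhs_neq.
have kr : `|k| <= rho.
  near: k; apply: nbhs_dnbhs; apply/nbhs_ballP; exists rho => //=.
  by move=> z; rewrite /ball /= sub0r normrN => /ltW.
have nk0 : 0 < `|k| by rewrite normr_gt0.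
have := H `|k| (p + k *: delta_mx ord0 j) e; rewrite nk0 kr => /(_ isT).
have cl : param_close `|k| (p + k *: delta_mx ord0 j) p e e.
  split => [i|]; last by rewrite subrr normr0.
  rewrite !mxE addrAC subrr add0r normrM ler_piMr // eqxx /=.
  by case: eqP; rewrite ?normr1 ?normr0.
move=> /(_ cl); rewrite /linear_form subrr mulr0 addr0 (bigD1 j) //= big1 ?addr0; last first.
  by move=> i ij; rewrite !mxE eqxx (negbTE ij) /= mulr0 addr0 subrr mulr0.
rewrite !mxE !eqxx mulr1 addrAC subrr add0r => le.
rewrite distrC -(ler_pM2r nk0) -normrM /= [k *: _ + p]addrC.
apply: le_trans le; rewrite le_eqVlt; apply/orP; left; apply/eqP; congr `|_|.
by rewrite mulrBl; congr (_ - _); rewrite /GRing.scale /= mulrC mulVKf.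
Unshelve. all: by end_near. Qed.

(* The second difference of [f] along [j] and [k] is symmetric; the mean value
   theorem along [j] compares it with [a j k]. *)
Lemma frechet_gradient_symmetric f (g : 'I_m -> 'rV[R]_m -> R -> R) p e a b :
  (forall q j, is_derive q (delta_mx ord0 j) f (g j q e)) ->
  (forall j, frechet (g j) p e (a j) (b j)) ->
  forall j k, a j k = a k j.
Proof.
move=> df fr.
pose dlt j : 'rV[R]_m := delta_mx ord0 j.
pose sd j k (s : R) :=
  f (p + s *: dlt j + s *: dlt k) - f (p + s *: dlt j) - f (p + s *: dlt k) + f p.
(* Two Frechet errors of at most [eta * s], times the length [s] of the interval; the terms
   [a j j * c] at the intermediate point cancel. *)
have half j k : j != k -> forall eta : R, 0 < eta ->
    exists rho : R, 0 < rho /\ forall s : R, 0 < s <= rho ->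
    `|sd k j s - s * (a j k * s)| <= 2 * (eta * s) * s.
  move=> jk eta eta0; have [rho [rho0 H]] := fr j eta eta0; exists rho; split => // s /andP[s0 sr].
  pose F t := f (p + s *: dlt k + t *: dlt j) - f (p + t *: dlt j).
  have dF (t : R) : is_derive t 1 F (g j (p + s *: dlt k + t *: dlt j) e - g j (p + t *: dlt j) e).
    apply: is_deriveB; apply: is_derive_line; exact: df.
  have cF : {within `[0, s], continuous F}.
    apply: continuous_subspaceT => t; apply/differentiable_continuous/derivable1_diffP.
    exact: (@ex_derive _ _ _ _ _ _ _ (dF t)).
  have [c] := MVT s0 (fun t _ => dF t) cF.
  rewrite in_itv /= => /andP[c0 cs] E.
  have sdE : sd k j s = F s - F 0 by rewrite /sd /F scale0r !addr0; ring.
  have st i (u : R) l : (u *: dlt i) ord0 l = u * (l == i)%:R by rewrite !mxE eqxx.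
  have cs' : c <= s by exact: ltW.
  have cl1 : param_close s (p + s *: dlt k + c *: dlt j) p e e.
    split => [l|]; last by rewrite subrr normr0 ltW.
    rewrite mxE [X in `|X + _ - _|]mxE !st addrAC (addrAC (p ord0 l)) subrr add0r.
    have [->|lk] := eqVneq l k.
      by rewrite (negbTE (_ : k != j)) 1?eq_sym // mulr1 mulr0 addr0 gtr0_norm.
    rewrite mulr0 add0r; case: eqP => _; last by rewrite mulr0 normr0 ltW.
    by rewrite mulr1 gtr0_norm.
  have cl2 : param_close s (p + c *: dlt j) p e e.
    split => [l|]; last by rewrite subrr normr0 ltW.
    rewrite mxE st addrAC subrr add0r.
    by case: eqP => _; rewrite ?mulr1 ?mulr0 ?normr0 ?gtr0_norm // ltW.
  have sr' : 0 < s <= rho by rewrite s0.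
  have E1 := H _ _ _ sr' cl1; have E2 := H _ _ _ sr' cl2.
  have L2 : linear_form (a j) (b j) (p + c *: dlt j - p) (e - e) = a j j * c.
    rewrite /linear_form subrr mulr0 addr0 (bigD1 j) //= big1 ?addr0.
      by rewrite addrAC subrr add0r st eqxx mulr1.
    by move=> l lj; rewrite addrAC subrr add0r st (negbTE lj) !mulr0.
  have L1 : linear_form (a j) (b j) (p + s *: dlt k + c *: dlt j - p) (e - e) =
      a j k * s + a j j * c.
    rewrite -L2 /linear_form subrr mulr0 !addr0.
    rewrite (_ : a j k * s = \sum_l a j l * (s *: dlt k) ord0 l).
      rewrite -big_split /=; apply: eq_bigr => l _; rewrite -mulrDr; congr (_ * _).
      by rewrite !mxE; ring.
    rewrite (bigD1 k) //= big1 ?addr0; first by rewrite st eqxx mulr1.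
    by move=> l lk; rewrite st (negbTE lk) !mulr0.
  rewrite L1 in E1; rewrite L2 in E2.
  rewrite sdE E subr0 [s * (_ * _)]mulrC -mulrBl normrM (gtr0_norm s0) ler_pM2r //.
  move: E1 E2; rewrite !ler_norml => /andP[? ?] /andP[? ?]; apply/andP; split; lra.
move=> j k; have [->//|jk] := eqVneq j k.
have kj : k != j by rewrite eq_sym.
apply/eqP; rewrite -subr_eq0 -normr_le0; apply/ler_addgt0Pr => eta eta0; rewrite add0r.
have eta4 : 0 < eta / 4 by rewrite divr_gt0.
have [r1 [r10 H1]] := half _ _ jk _ eta4; have [r2 [r20 H2]] := half _ _ kj _ eta4.
pose s := Num.min r1 r2.
have s0 : 0 < s by rewrite lt_min r10.
have := H1 s; rewrite s0 ge_min lexx => /(_ isT) h1.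
have := H2 s; rewrite s0 ge_min lexx orbT => /(_ isT) h2.
have sdC : sd k j s = sd j k s by rewrite /sd (addrAC p (s *: dlt k)); ring.
rewrite sdC in h1.
have ss : 0 < s * s by rewrite mulr_gt0.
rewrite -(ler_pM2r ss) -[X in _ * X](gtr0_norm ss) -normrM.
move: h1 h2; move: (sd j k s) => X; rewrite !ler_norml => /andP[? ?] /andP[? ?].
apply/andP; split; lra.
Qed.

End SecondDerivative.

(** * The differential equation *)

Section Deriv01.
Context (R : realType).
Implicit Types (f : R -> R) (x l : R).

Lemma is_deriv01P f x l : is_deriv01 f x l <->
  forall eta, 0 < eta -> exists rho, 0 < rho /\ forall e, 0 <= e <= 1 -> e != x ->
    `|e - x| < rho -> `|(f e - f x) / (e - x) - l| <= eta.
Proof.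
split.
  move=> /cvgrPdist_le H eta /H /nbhs_ballP[rho /= rho0 Hr].
  exists rho; split => // e e01 ex er; rewrite distrC.
  by apply: Hr => //; rewrite /ball /= distrC.
move=> H; apply/cvgrPdist_le => eta /H[rho [rho0 Hr]].
apply/nbhs_ballP; exists rho => //= e; rewrite /ball /= distrC => er ex.
by rewrite in_itv /= distrC => e01; exact: Hr.
Qed.

(** Small steps stay in the interval when directed to the right from the left half and to the left
    from the right half. Properness is what identifies the [lim] in [deriv01]. *)
Lemma within01_proper x : 0 <= x <= 1 -> ProperFilter (within `[0, 1] x^').
Proof.
move=> /andP[x0 x1]; apply: Build_ProperFilter_ex => P /nbhs_ballP[rho /= rho0 H].
pose r := Num.min (rho / 2) 2^-1.
have r0 : 0 < r by rewrite lt_min divr_gt0 //= invr_gt0.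
have rr : r <= rho / 2 by rewrite ge_min lexx.
have r2 : r <= 2^-1 by rewrite ge_min lexx orbT.
have [x2|x2] := leP x 2^-1.
  exists (x + r); apply: H; rewrite /ball /=.
  - by rewrite opprD addrA subrr sub0r normrN gtr0_norm //; lra.
  - by rewrite gt_eqF // ltrDl.
  - by rewrite in_itv /=; apply/andP; split; lra.
exists (x - r); apply: H; rewrite /ball /=.
- by rewrite opprB addrC subrK gtr0_norm //; lra.
- by rewrite lt_eqF // ltrBlDr ltrDl.
- by rewrite in_itv /=; apply/andP; split; lra.
Qed.

Lemma deriv01E f x l : 0 <= x <= 1 -> is_deriv01 f x l -> deriv01 f x = l.
Proof. by move=> x01 H; apply: (@cvg_lim _ _ _ _ (within01_proper x01)). Qed.

(** The clamp [cl] onto the interval is 1-Lipschitz, so [f] composed with it is continuous on the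
    whole line and the mean value theorem applies; at interior points the relative derivative is the
    ordinary one. *)
Lemma deriv01_zero_cst f : (forall x, 0 <= x <= 1 -> is_deriv01 f x 0) ->
  forall x, 0 <= x <= 1 -> f x = f 0.
Proof.
move=> Hf x /andP[x0 x1].
pose cl (e : R) := Num.max 0 (Num.min e 1).
have cl01 e : 0 <= cl e <= 1 by rewrite /cl le_max lexx /= ge_max ler01 ge_min lexx orbT.
have clE e : 0 <= e <= 1 -> cl e = e by move=> /andP[e0 e1]; rewrite /cl min_l // max_r.
have cl_lip e e' : `|cl e - cl e'| <= `|e - e'|.
  have := ler_norm (e - e'); have := ler_norm (e' - e); rewrite (distrC e') ler_norml /cl.
  by have [?|?] := leP e 1; have [?|?] := leP e' 1;
    rewrite ?(max_r (ler01 : 0 <= 1)); try (have [?|?] := leP 0 e);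
    try (have [?|?] := leP 0 e'); move=> *; apply/andP; split; lra.
pose g e := f (cl e).
have gE e : 0 <= e <= 1 -> g e = f e by move=> /clE E; rewrite /g E.
have lip z (eta : R) : 0 <= z <= 1 -> 0 < eta -> exists rho, 0 < rho /\
    forall e, 0 <= e <= 1 -> `|e - z| < rho -> `|f e - f z| <= eta * `|e - z|.
  move=> z01 eta0; have /is_deriv01P /(_ _ eta0)[rho [rho0 H]] := Hf z z01.
  exists rho; split => // e e01 er; have [->|ez] := eqVneq e z.
    by rewrite !subrr normr0 mulr0.
  have := H e e01 ez er; rewrite subr0 normrM normfV ler_pdivrMr //.
  by rewrite normr_gt0 subr_eq0.
have cg : continuous g.
  move=> z; apply/cvgrPdist_le => eta eta0.
  have [rho [rho0 H]] := lip (cl z) 1 (cl01 z) ltr01.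
  apply/nbhs_ballP; exists (Num.min rho eta); first by rewrite /= lt_min rho0.
  move=> e; rewrite /ball /= distrC lt_min => /andP[e1 e2]; rewrite distrC.
  apply: (@le_trans _ _ `|cl e - cl z|).
    by rewrite -[leRHS]mul1r; apply: H => //; apply: le_lt_trans e1.
  by apply: le_trans (ltW e2).
have [->//|xn0] := eqVneq x 0.
have xp : 0 < x by rewrite lt_neqAle eq_sym xn0.
have dg (c : R) : c \in `]0, x[ -> is_derive c 1 g 0.
  rewrite in_itv /= => /andP[c0 cx].
  suff cv : (fun h : R => h^-1 *: ((g \o shift c) (h *: 1) - g c)) @ 0^' --> 0.
    by split; [exact: (cvgP _ cv)|exact: (cvg_lim _ cv)].
  apply/cvgrPdist_le => eta eta0.
  have c01 : 0 <= c <= 1 by apply/andP; split; lra.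
  have [rho [rho0 H]] := lip c eta c01 eta0.
  pose r := Num.min rho (Num.min c (1 - c)).
  apply/nbhs_ballP; exists r => /=.
    by rewrite !lt_min rho0 c0 /= subr_gt0 (lt_le_trans cx).
  move=> k; rewrite /ball /= sub0r normrN !lt_min => /and3P[k1 k2 k3] k0.
  have kc : 0 <= k + c <= 1.
    by move: k2 k3; rewrite !ltr_norml => /andP[? ?] /andP[? ?]; apply/andP; split; lra.
  rewrite sub0r normrN -[k *: 1]/(k * 1) mulr1 !gE // /GRing.scale /= normrM normfV.
  rewrite mulrC ler_pdivrMr ?normr_gt0 //.
  have := H (k + c) kc; rewrite addrK; exact.
have [c _] := MVT xp dg (continuous_subspaceT cg).
rewrite mul0r => /eqP; rewrite subr_eq0 !gE ?lexx ?ler01 ?x1 ?x0 // ?(ltW xp) //.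
by move=> /eqP.
Qed.

End Deriv01.

Lemma frechet_deriv01 (R : realType) m (f : 'rV[R]_m -> R -> R) p e a b :
  frechet f p e a b -> is_deriv01 (f p) e b.
Proof.
move=> fr; apply/is_deriv01P => eta eta0; have [rho [rho0 H]] := fr eta eta0.
exists rho; split => // e' _ ne er.
have n0 : 0 < `|e' - e| by rewrite normr_gt0 subr_eq0.
have := H `|e' - e| p e'; rewrite n0 (ltW er) => /(_ isT).
have cl : param_close `|e' - e| p p e' e by split => // j; rewrite subrr normr0.
move=> /(_ cl); rewrite /linear_form subrr big1 ?add0r => [|j _]; last by rewrite mxE mulr0.
by move=> le; rewrite -(ler_pM2r n0) -normrM mulrBl divfK // subr_eq0.
Qed.

Lemma frechet_cstB (R : realType) m (f : 'rV[R]_m -> R -> R) c p e a b :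
  frechet f p e a b -> frechet (fun p e => c - f p e) p e (fun j => - a j) (- b).
Proof.
move=> fr eta /fr[rho [rho0 H]]; exists rho; split => // r q e' r0 cl.
rewrite (_ : _ - _ - _ = - (f q e' - f p e - linear_form a b (q - p) (e' - e))).
  by rewrite normrN; exact: H.
rewrite /linear_form (_ : \sum_j - a j * _ = - \sum_j a j * (q - p) ord0 j); first by ring.
by rewrite -sumrN; apply: eq_bigr => j _; rewrite mulNr.
Qed.

(** * Invertibility of the Hessian and the flow of critical points *)

Section Flow.
Context (R : realType) (Om : set (R * R)) (n : nat) (y : 'I_n.+1 -> R * R).
Context (yh : forall i j, i != j -> (y i).2 != (y j).2).
Context (Om_measurable : measurable (Om : set (measurableTypeR R * measurableTypeR R))).
Context (Om_area : leb2 Om = 1%E) (Om_convex : convex2 Om).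
Context (lo up : R -> R) (B : R) (B0 : 0 < B).
Context (Om_section : forall t s0, Om (t, s0) ->
    forall s, Om (t, s) <-> lo t <= s <= up t).
Context (Om_bounded : forall x, Om x -> `|x.1| <= B /\ `|x.2| <= B).
Implicit Types (p q : 'rV[R]_n.+1) (e : R).
Local Notation C := (cell Om y).
Local Notation N := (n.+1%:R^-1 : R).
Local Notation lft := (lift ord0).

Let Om_fin : (leb2 Om < +oo)%E. Proof. by rewrite Om_area ltry. Qed.

(** The full gradient of [Phi], the normalised index [ord0] included. As the total area is 1, the
    components sum to zero and the one at [ord0] is determined by the others. *)
Let G (j : 'I_n.+1) q e : R := N - area (C q e j).

Lemma dPhiE i q e : dPhi Om y i q e = G (lft i) q e.
Proof.
exact: (@derive_val _ _ _ _ _ _ _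
  (is_derive_Phi yh Om_measurable Om_fin B0 Om_bounded Om_section q e (lft i))).
Qed.

Let sumG q e : \sum_j G j q e = 0.
Proof.
rewrite sumrB (sum_area yh Om_measurable Om_fin q e) Om_area /= sumr_const card_ord.
by rewrite -[X in X - _]mulr_natl divff ?subrr // pnatr_eq0.
Qed.

Let areaE j q e : G j q e = 0 -> area (C q e j) = N.
Proof. by move=> /eqP; rewrite subr_eq0 => /eqP. Qed.

Lemma area_determined q e : (forall i : 'I_n, G (lft i) q e = 0) -> forall j, area (C q e j) = N.
Proof.
move=> H j; apply: areaE; have [i ->|->] := unliftP ord0 j; first exact: H.
by have := sumG q e; rewrite big_ord_recl big1 ?addr0.
Qed.

Lemma linear_form_lift (a : 'I_n.+1 -> R) b q e : q ord0 ord0 = 0 ->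
  linear_form a b q e = \sum_i a (lft i) * q ord0 (lft i) + b * e.
Proof. by move=> q0; rewrite /linear_form big_ord_recl q0 mulr0 add0r. Qed.

Section AtPoint.
Context (p0 : 'rV[R]_n.+1) (e0 : R) (e01 : 0 <= e0 <= 1).
Context (area_gt0 : forall i, 0 < area (C p0 e0 i)).

Lemma gradient_frechet : exists a b, (forall j, frechet (G j) p0 e0 (a j) (b j)) /\
  forall j k, a j k = a k j.
Proof.
have /choice[ab Hab] : forall j, exists ab : ('I_n.+1 -> R) * R, frechet (G j) p0 e0 ab.1 ab.2.
  move=> j; have [a [b H]] := frechet_area yh Om_measurable Om_fin Om_convex B0 Om_section
    Om_bounded area_gt0 j.
  by exists (fun k => - a k, - b); exact: frechet_cstB.
exists (fun j => (ab j).1), (fun j => (ab j).2); split=> //.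
apply: (@frechet_gradient_symmetric _ _ (Phi Om y ^~ e0) G p0 e0 _ (fun j => (ab j).2)) => // q j.
exact: (is_derive_Phi yh Om_measurable Om_fin B0 Om_bounded Om_section q e0 j).
Qed.

(** The component at [ord0] is minus the sum of the others, so dropping it costs at most a factor
    2. *)
Lemma area_injectivity_lift : exists c d, [/\ 0 < c, 0 < d & forall q k,
  q ord0 ord0 = p0 ord0 ord0 ->
  c * Num.min `|q ord0 k - p0 ord0 k| d <= \sum_i `|G (lft i) q e0 - G (lft i) p0 e0|].
Proof.
have [c [d [c0 d0 H]]] := area_injectivity yh Om_measurable Om_fin Om_convex B0 Om_bounded area_gt0.
exists (c / 2), d; split => //; first by rewrite divr_gt0.
move=> q k /(H q k); rewrite big_ord_recl /=.
have diff j : area (C q e0 j) - area (C p0 e0 j) = - (G j q e0 - G j p0 e0).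
  by rewrite /G; ring.
under eq_bigr do rewrite diff normrN.
rewrite diff normrN.
have -> : G ord0 q e0 - G ord0 p0 e0 = - \sum_i (G (lft i) q e0 - G (lft i) p0 e0).
  rewrite [RHS](_ : _ = - (\sum_i G (lft i) q e0 - \sum_i G (lft i) p0 e0)); last by rewrite -sumrB.
  have := sumG q e0; have := sumG p0 e0; rewrite !big_ord_recl.
  by move=> /eqP; rewrite addr_eq0 => /eqP-> /eqP; rewrite addr_eq0 => /eqP->; ring.
rewrite normrN.
have := ler_norm_sum (index_enum 'I_n) (fun i => G (lft i) q e0 - G (lft i) p0 e0) predT.
by move: (Num.min _ _) => m *; rewrite mulrAC; lra.
Qed.

Context (a : 'I_n.+1 -> 'I_n.+1 -> R) (b : 'I_n.+1 -> R).
Context (fr : forall j, frechet (G j) p0 e0 (a j) (b j)) (sym : forall j k, a j k = a k j).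

(** [hessPhi] differentiates component [j] in direction [i], whence the exchanged indices; the
    symmetry of [a] reconciles them with the expansion of the gradient. *)
Lemma hessE i j : hessPhi Om y p0 e0 i j = a (lft j) (lft i).
Proof.
rewrite mxE; under [fun q => _]eq_fun do rewrite dPhiE.
exact: (@derive_val _ _ _ _ _ _ _ (frechet_derive (lft i) (fr (lft j)))).
Qed.

Lemma depsE i : deps_gradPhi Om y p0 e0 i ord0 = b (lft i).
Proof.
rewrite mxE; under [fun e => _]eq_fun do rewrite dPhiE.
by apply: deriv01E => //; exact: frechet_deriv01 (fr (lft i)).
Qed.

Let frechet_uniform (eta : R) : 0 < eta -> exists rho, 0 < rho /\ forall j r p e,
  0 < r <= rho -> param_close r p p0 e e0 ->
  `|G j p e - G j p0 e0 - linear_form (a j) (b j) (p - p0) (e - e0)| <= eta * r.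
Proof.
move=> eta0; have /choice[f Hf] := fun j => fr j eta0.
have f0 j : 0 < f j by have [] := Hf j.
have [m m0 Hm] := finite_lower_bound f0.
exists m; split => // j r p e /andP[r0 rm] cl; have [_ H] := Hf j.
by apply: H => //; rewrite r0 (le_trans rm).
Qed.

(** Along a left kernel vector [v] the gradient has no linear term, so a step [s] changes it by
    [o(s)], whereas the injectivity estimate demands at least [c * (s * |v k|)]. With the chosen
    [eta] the [n] errors add up to at most half of this. *)
Lemma hess_unitmx : hessPhi Om y p0 e0 \in unitmx.
Proof.
set H := hessPhi Om y p0 e0.
suff ker0 (v : 'rV[R]_n) : v *m H = 0 -> v = 0.
  rewrite -row_free_unit -kermx_eq0; apply/eqP/row_matrixP => i; rewrite row0.
  by apply: ker0; rewrite -row_mul mulmx_ker row0.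
move=> vH; apply/rowP => k; rewrite [RHS]mxE; apply/eqP; apply: contraT => vk.
pose V : 'rV[R]_n.+1 := \row_j (if unlift ord0 j is Some i then v ord0 i else 0).
have V0 : V ord0 ord0 = 0 by rewrite mxE unlift_none.
have Vl i : V ord0 (lft i) = v ord0 i by rewrite mxE liftK.
pose M := 1 + \sum_j `|V ord0 j|.
have M0 : 0 < M by rewrite ltr_pwDl // sumr_ge0.
have VM j : `|V ord0 j| <= M.
  by rewrite /M (bigD1 j) //= addrCA lerDl addr_ge0 // sumr_ge0.
have vk0 : 0 < `|v ord0 k| by rewrite normr_gt0.
have [c [d [c0 d0 inj]]] := area_injectivity_lift.
pose eta := c * `|v ord0 k| / (2 * n.+1%:R * M).
have eta0 : 0 < eta by rewrite divr_gt0 ?mulr_gt0.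
have [rho [rho0 Hr]] := frechet_uniform eta0.
(* The first bound keeps the cap [d] inactive, the second keeps the displacement within [rho]. *)
pose s := Num.min (d / `|v ord0 k|) (rho / M).
have s0 : 0 < s by rewrite lt_min !divr_gt0.
have sd : s * `|v ord0 k| <= d by rewrite -ler_pdivlMr // ge_min lexx.
have sM : s * M <= rho by rewrite -ler_pdivlMr // ge_min lexx orbT.
pose q := p0 + s *: V.
have qE j : q ord0 j - p0 ord0 j = s * V ord0 j by rewrite !mxE addrAC subrr add0r.
have cl : param_close (s * M) q p0 e0 e0.
  split=> [j|]; last by rewrite subrr normr0 mulr_ge0 ?ltW.
  by rewrite qE normrM (gtr0_norm s0) ler_pM2l.
have q0 : q ord0 ord0 = p0 ord0 ord0 by apply/eqP; rewrite -subr_eq0 qE V0 mulr0.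
have := inj q (lft k) q0; rewrite qE Vl normrM (gtr0_norm s0) min_l // leNgt => /negP; case.
have small i : `|G (lft i) q e0 - G (lft i) p0 e0| <= eta * (s * M).
  have := Hr (lft i) (s * M) q e0; rewrite sM mulr_gt0 // => /(_ isT cl).
  rewrite subrr linear_form_lift ?mulr0 ?addr0; last by rewrite mxE [X in _ + X]mxE qE V0 mulr0.
  rewrite (_ : \sum_i0 _ = s * (v *m H) ord0 i).
    by rewrite vH mxE mulr0 subr0.
  rewrite mxE mulr_sumr; apply: eq_bigr => l _.
  by rewrite mxE [X in _ + X]mxE qE Vl hessE; ring.
apply: (@le_lt_trans _ _ (\sum_(i < n) eta * (s * M))); first exact: ler_sum.
rewrite sumr_const card_ord -[X in X < _]mulr_natl.
apply: (@le_lt_trans _ _ (n.+1%:R * (eta * (s * M)))).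
  apply: ler_wpM2r; first exact: ltW (mulr_gt0 eta0 (mulr_gt0 s0 M0)).
  by rewrite ler_nat.
rewrite (_ : n.+1%:R * _ = c * (s * `|v ord0 k|) / 2).
  by rewrite ltr_pdivrMr // ltr_pMr ?ltr1n // !mulr_gt0.
rewrite /eta; field; apply/andP; split; first by rewrite gt_eqF.
by rewrite nat1r pnatr_eq0.
Qed.

Let H := hessPhi Om y p0 e0.
Let W := deps_gradPhi Om y p0 e0.
Let rate := - (invmx H *m W).

Let rate_eq i : \sum_k a (lft i) (lft k) * rate k ord0 + b (lft i) = 0.
Proof.
have E : H *m rate + W = 0 by rewrite /rate mulmxN mulKVmx ?addNr // hess_unitmx.
have E2 : (H *m rate + W) i ord0 = 0 by rewrite E mxE.
apply: etrans E2; rewrite mxE [X in _ = X + _]mxE (depsE i : W i ord0 = _).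
by congr (_ + _); apply: eq_bigr => k _; rewrite (hessE i k : H i k = _) sym.
Qed.

(** As the gradient vanishes at [(p e, e)], its components at [(p e, e0)] are at most
    [K * |e - e0|], and the injectivity estimate turns this into [|p e - p0| <= L * |e - e0|]. The
    Frechet expansion with this radius then says that the difference quotients nearly solve the
    linear system for [rate]. *)
Lemma curve_derivative (p : R -> 'rV[R]_n.+1) : p e0 = p0 ->
  (forall e, 0 <= e <= 1 -> p e ord0 ord0 = p0 ord0 ord0) ->
  (forall e i, 0 <= e <= 1 -> G (lft i) (p e) e = 0) ->
  forall i, is_deriv01 (fun e => p e ord0 (lft i)) e0 (rate i ord0).
Proof.
move=> pe0 p00 pG i.
have Gp0 l : G (lft l) p0 e0 = 0 by rewrite -pe0 pG.
have [K [K0 HK]] := area_lipschitz yh Om_measurable Om_fin B0 Om_section Om_bounded.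
have [c [d [c0 d0 inj]]] := area_injectivity_lift.
pose K1 := n.+1%:R * K + 1.
have K10 : 0 < K1 by rewrite ltr_wpDl ?mulr_ge0.
pose L := K1 / c + 1.
have L1 : 1 <= L by rewrite /L lerDr divr_ge0 ?ltW.
have lip e : 0 <= e <= 1 -> `|e - e0| < c * d / K1 ->
    forall j, `|p e ord0 j - p0 ord0 j| <= L * `|e - e0|.
  move=> ee1 near j.
  have bd : c * Num.min `|p e ord0 j - p0 ord0 j| d <= K1 * `|e - e0|.
    apply: le_trans (inj (p e) j (p00 e ee1)) _.
    apply: (@le_trans _ _ (\sum_(l < n) K * `|e - e0|)).
      apply: ler_sum => l _; rewrite Gp0 -(pG e l ee1).
      rewrite (_ : _ - _ = area (C (p e) e (lft l)) - area (C (p e) e0 (lft l))).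
        by apply: HK; split=> [m|//]; rewrite subrr normr0.
      by rewrite /G; ring.
    rewrite sumr_const card_ord -[X in X <= _]mulr_natl mulrA ler_wpM2r // /K1.
    apply: (@le_trans _ _ (n.+1%:R * K)); last by rewrite lerDl.
    by rewrite ler_wpM2r // ler_nat.
  (* For [|e - e0| < c * d / K1] the cap [d] cannot be the smaller term. *)
  have [dl|dl] := leP d `|p e ord0 j - p0 ord0 j|.
    move: bd; rewrite min_r // leNgt; rewrite ltr_pdivlMr // mulrC in near.
    by rewrite near.
  move: bd; rewrite min_l ?(ltW dl) // => bd.
  rewrite /L mulrDl mul1r; apply: (@le_trans _ _ (K1 / c * `|e - e0|)); last by rewrite lerDl.
  by rewrite mulrAC ler_pdivlMr // mulrC.
apply/is_deriv01P => eta eta0.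
(* [S] bounds a row sum of the inverse Hessian: an error [eta' * L] in every equation becomes at
   most [eta] in the [i]-th unknown. *)
pose S := \sum_j `|invmx H i j| + 1.
have S0 : 0 < S by rewrite ltr_wpDl // sumr_ge0.
have L0 : 0 < L by apply: lt_le_trans L1.
pose eta' := eta / (S * L).
have eta'0 : 0 < eta' by rewrite divr_gt0 // mulr_gt0.
have [rho [rho0 Hr]] := frechet_uniform eta'0.
exists (Num.min (c * d / K1) (rho / L)); split; first by rewrite lt_min !divr_gt0 ?mulr_gt0.
move=> e ee1 ne; rewrite lt_min => /andP[near1]; rewrite ltr_pdivlMr // mulrC => near2.
have ne0 : e - e0 != 0 by rewrite subr_eq0.
have n0 : 0 < `|e - e0| by rewrite normr_gt0.
have cl : param_close (L * `|e - e0|) (p e) p0 e e0.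
  by split=> [j|]; [exact: lip|rewrite ler_peMl].
pose D : 'cV[R]_n := \col_l ((p e ord0 (lft l) - p0 ord0 (lft l)) / (e - e0)).
have HD l : `|(H *m D + W) l ord0| <= eta' * L.
  have := Hr (lft l) _ _ _ (_ : 0 < L * `|e - e0| <= rho) cl.
  rewrite mulr_gt0 // (ltW near2) => /(_ isT).
  rewrite pG // Gp0 subrr sub0r normrN linear_form_lift; last first.
    by rewrite !mxE p00 // subrr.
  move=> le.
  have E : (H *m D + W) l ord0 * (e - e0) =
      \sum_k a (lft l) (lft k) * (p e - p0) ord0 (lft k) + b (lft l) * (e - e0).
    rewrite mxE [X in (X + _) * _]mxE (depsE l : W l ord0 = _) mulrDl.
    congr (_ + _); rewrite mulr_suml; apply: eq_bigr => k _.
    by rewrite (hessE l k : H l k = _) sym !mxE -mulrA divfK.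
  by rewrite -(ler_pM2r n0) -normrM E -mulrA.
have HDE : invmx H *m (H *m D + W) = D - rate.
  by rewrite mulmxDr mulKmx ?hess_unitmx // /rate opprK.
rewrite pe0 (_ : _ - _ = (D - rate) i ord0); last by rewrite !mxE.
rewrite -HDE mxE; apply: (le_trans (ler_norm_sum _ _ _)).
apply: (@le_trans _ _ (\sum_j `|invmx H i j| * (eta' * L))).
  by apply: ler_sum => j _; rewrite normrM ler_wpM2l.
rewrite -mulr_suml; apply: (@le_trans _ _ (S * (eta' * L))).
  apply: ler_wpM2r; first exact: ltW (mulr_gt0 eta'0 L0).
  by rewrite /S lerDl.
by rewrite /eta' le_eqVlt; apply/orP; left; apply/eqP; field; rewrite !gt_eqF.
Qed.

(** Chain rule along [q]: the first-order term vanishes by [rate_eq], and the errors of the gradient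
    and of [q] get [eta / 2] each. *)
Lemma gradient_constant (q : R -> 'rV[R]_n.+1) : q e0 = p0 ->
  (forall e, 0 <= e <= 1 -> q e ord0 ord0 = p0 ord0 ord0) ->
  (forall i, is_deriv01 (fun e => q e ord0 (lft i)) e0 (rate i ord0)) ->
  forall i, is_deriv01 (fun e => G (lft i) (q e) e) e0 0.
Proof.
move=> qe0 q00 dq i; apply/is_deriv01P => eta eta0.
pose A := 1 + \sum_k `|a (lft i) (lft k)|.
have A0 : 0 < A by rewrite ltr_pwDl // sumr_ge0.
pose L := 1 + \sum_k (`|rate k ord0| + 1).
have L0 : 0 < L by rewrite ltr_pwDl // sumr_ge0 // => k _; rewrite addr_ge0.
(* The bound 1 ensures [|q e - p0| <= L * |e - e0|], the other one [A * eta1 <= eta / 2]. *)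
pose eta1 := Num.min 1 (eta / (2 * A)).
have eta10 : 0 < eta1 by rewrite lt_min ltr01 divr_gt0 // mulr_gt0.
have e2L0 : 0 < eta / (2 * L) by rewrite divr_gt0 // mulr_gt0.
have [rho [rho0 Hr]] := frechet_uniform e2L0.
have /choice[f Hf] : forall k, exists rho, 0 < rho /\ forall e, 0 <= e <= 1 -> e != e0 ->
    `|e - e0| < rho -> `|(q e ord0 (lft k) - p0 ord0 (lft k)) / (e - e0) - rate k ord0| <= eta1.
  by move=> k; have /is_deriv01P /(_ _ eta10) := dq k; rewrite qe0.
have f0 k : 0 < f k by have [] := Hf k.
have [m m0 Hm] := finite_lower_bound f0.
exists (Num.min m (rho / L)); split; first by rewrite lt_min m0 divr_gt0.
move=> e ee1 ne; rewrite lt_min => /andP[near1]; rewrite ltr_pdivlMr // mulrC => near2.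
have ne0 : e - e0 != 0 by rewrite subr_eq0.
have n0 : 0 < `|e - e0| by rewrite normr_gt0.
have dk k : `|q e ord0 (lft k) - p0 ord0 (lft k) - rate k ord0 * (e - e0)| <= eta1 * `|e - e0|.
  have [_ /(_ e ee1 ne (lt_le_trans near1 (Hm k)))] := Hf k.
  by rewrite -(ler_pM2r n0) -normrM mulrBl divfK.
have cl : param_close (L * `|e - e0|) (q e) p0 e e0.
  split=> [j|]; last by rewrite ler_peMl // /L lerDl sumr_ge0 // => k _; rewrite addr_ge0.
  have [k ->|->] := unliftP ord0 j; last by rewrite q00 // subrr normr0 mulr_ge0 // ltW.
  apply: (@le_trans _ _ ((`|rate k ord0| + 1) * `|e - e0|)); last first.
    rewrite ler_pM2r // /L (bigD1 k) //= addrCA lerDl.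
    by apply: addr_ge0 => //; apply: sumr_ge0 => l _; apply: addr_ge0.
  rewrite -[X in `|X|](subrK (rate k ord0 * (e - e0))) (le_trans (ler_normD _ _)) //.
  rewrite mulrDl mul1r addrC normrM lerD2l (le_trans (dk k)) //.
  by rewrite ler_piMl // ge_min lexx.
have := Hr (lft i) _ _ _ (_ : 0 < L * `|e - e0| <= rho) cl.
rewrite mulr_gt0 // (ltW near2) => /(_ isT).
rewrite linear_form_lift; last by rewrite mxE [X in _ + X]mxE q00 // subrr.
rewrite (_ : \sum_k _ + _ = \sum_k a (lft i) (lft k) *
    (q e ord0 (lft k) - p0 ord0 (lft k) - rate k ord0 * (e - e0))); last first.
  rewrite (_ : b (lft i) = - \sum_k a (lft i) (lft k) * rate k ord0); last first.
    by apply/eqP; rewrite -addr_eq0 addrC rate_eq.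
  rewrite mulNr mulr_suml -sumrB; apply: eq_bigr => k _; rewrite !mxE; ring.
set lin := \sum_k _ => le.
have lin_le : `|lin| <= eta / 2 * `|e - e0|.
  apply: (le_trans (ler_norm_sum _ _ _)).
  apply: (@le_trans _ _ (\sum_k `|a (lft i) (lft k)| * (eta1 * `|e - e0|))).
    by apply: ler_sum => k _; rewrite normrM ler_wpM2l.
  rewrite -mulr_suml mulrA ler_pM2r //.
  apply: (@le_trans _ _ (A * eta1)); first by rewrite ler_pM2r // /A lerDr.
  apply: (@le_trans _ _ (A * (eta / (2 * A)))); first by rewrite ler_pM2l // ge_min lexx orbT.
  by rewrite le_eqVlt; apply/orP; left; apply/eqP; field; rewrite gt_eqF.
have eL : eta / (2 * L) * (L * `|e - e0|) = eta / 2 * `|e - e0|.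
  by field; rewrite gt_eqF.
rewrite eL in le.
rewrite qe0 subr0 normrM normfV ler_pdivrMr //.
rewrite -[X in `|X|](subrK lin) (le_trans (ler_normD _ _)) //.
by rewrite (splitr eta) mulrDl lerD.
Qed.

End AtPoint.
End Flow.

Theorem theorem3p5 (R : realType) (Omega : set (R * R)) (n : nat)
    (y : 'I_n.+1 -> R * R) (p : R -> 'rV[R]_n.+1)
    (Omega_polygon : convex_polygon Omega)
    (Omega_area : leb2 Omega = 1%E)
    (y_Omega : forall i, Omega (y i))
    (y_heights : forall i j, i != j -> (y i).2 != (y j).2)
    (p_dual : forall eps : R, 0 <= eps <= 1 -> dual_solution Omega y eps (p eps)) :
  [/\ ode_solution Omega y p,
      initial_condition Omega y (p 0) &
      forall q : R -> 'rV[R]_n.+1,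
        ode_solution Omega y q -> initial_condition Omega y (q 0) ->
        forall eps : R, 0 <= eps <= 1 -> q eps = p eps].
Proof.
have cO := convex_polygon_compact Omega_polygon.
have vO := convex_polygon_convex Omega_polygon.
have mO : measurable (Omega : set (measurableTypeR R * measurableTypeR R)).
  by apply: closed_measurable2; apply: compact_closed => //; exact: norm_hausdorff.
have [lo [up sec]] := compact_convex2_sections cO vO.
have [B [B0 bd]] := compact2_bounded cO.
have fO : (leb2 Omega < +oo)%E by rewrite Omega_area ltry.
have N0 : 0 < n.+1%:R^-1 :> R by rewrite invr_gt0.
have pE e j : 0 <= e <= 1 -> area (cell Omega y (p e) e j) = n.+1%:R^-1.
  move=> e01; apply: (maximizer_area y_heights mO fO B0 bd sec).
  exact: (p_dual e e01).2.
have p0 e : 0 <= e <= 1 -> p e ord0 ord0 = 0 by move=> e01; exact: (p_dual e e01).1.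
have pos e : 0 <= e <= 1 -> forall j, 0 < area (cell Omega y (p e) e j).
  by move=> e01 j; rewrite pE.
split.
- move=> e e01; split.
    split => [|//|i]; first exact: p0.
    rewrite pE // invfM; apply/andP; split; last by rewrite mulrC ltr_pMr // ltr1n.
    by rewrite gtr_pMl // invf_lt1 ?ltr1n.
  have [a [b [fr sy]]] := gradient_frechet y_heights mO Omega_area vO B0 sec bd (pos e e01).
  apply: (curve_derivative y_heights mO Omega_area vO B0 sec bd e01 (pos e e01) fr sy) => //.
    by move=> e' e'01; rewrite !p0.
  by move=> e' i e'01; rewrite pE // subrr.
- by move=> i; rewrite pE // lexx ler01.
- move=> q q_ode q_init e e01.
  have q0 e' : 0 <= e' <= 1 -> q e' ord0 ord0 = 0 by move=> /q_ode[[]].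
  have qG i : n.+1%:R^-1 - area (cell Omega y (q e) e (lift ord0 i)) = 0.
    rewrite (@deriv01_zero_cst _
      (fun e => n.+1%:R^-1 - area (cell Omega y (q e) e (lift ord0 i)))) //.
      by rewrite q_init subrr.
    move=> e' e'01; have [[_ _ dom] dq] := q_ode e' e'01.
    (* The lower bound in [ode_domain] keeps all cells of [q] of positive area, as the expansion at
       [q e'] requires. *)
    have qpos j : 0 < area (cell Omega y (q e') e' j).
      have /andP[lb _] := dom j; apply: lt_trans lb.
      by rewrite invr_gt0 mulr_gt0.
    have [a [b [fr sy]]] := gradient_frechet y_heights mO Omega_area vO B0 sec bd qpos.
    apply: (gradient_constant y_heights mO Omega_area vO B0 sec bd e'01 qpos fr sy) => //.
    by move=> e'' e''01; rewrite !q0.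
  have qE := area_determined y_heights mO Omega_area qG.
  (* All areas are [1/N] for both [q e] and [p e], so the estimate based at [p e], valid for every
     [q], identifies them at this [e]. *)
  have [c [d [c0 d0 inj]]] := area_injectivity y_heights mO fO vO B0 bd (pos e e01).
  apply/rowP => k; apply/eqP; rewrite -subr_eq0 -normr_le0.
  have := inj (q e) k; rewrite q0 // p0 // => /(_ erefl).
  rewrite big1 => [|i _]; last by rewrite qE pE // subrr normr0.
  by rewrite pmulr_rle0 // ge_min (leNgt d) d0 orbF.
Qed.
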